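(* Let $(u,v,w)$ be a triple of weights on $\mathbb{R}$ and let $t\in\mathbb{R}$. The $t$-Haar multipliers $T^t_{w,\sigma}$ are bounded from $L^2(u)$ into $L^2(v)$ uniformly in the choice of signs $\sigma$ if and only if the following four conditions hold. (i) (Joint three-weight condition) $$C_1:=\sup_{I\in\mathcal{D}} \frac{\langle u^{-1}\rangle_I \,\langle v w^{2t}\rangle_I}{\langle w\rangle_I^{2t}} <\infty .$$ (ii) (Carleson condition) There is a constant $C_2>0$ such that for all $I\in\mathcal{D}$, $$\frac{1}{|I|} \sum_{J\in\mathcal{D}:\, J\subset I} |J|\,|\Delta_J(u^{-1})|^2\, \frac{\langle vw^{2t}\rangle_J}{\langle w\rangle_J^{2t}}\leq C_2\,\langle u^{-1}\rangle_I .$$ (iii) (Dual Carleson condition) There is a constant $C_3>0$ such that for all $I\in\mathcal{D}$, $$\frac{1}{|I|} \sum_{J\in\mathcal{D}:\, J\subset I} |J|\,|\Delta_J (vw^{2t})|^2\, \frac{\langle u^{-1}\rangle_J}{\langle w\rangle_J^{2t}}\leq C_3\, \langle vw^{2t} \rangle_I .$$ (iv) The positive operator $$P^t_{w,\lambda}f(x) := \sum_{I\in\mathcal{D}} \frac{w^t(x)}{|I|}\,\lambda_I\, \langle f\rangle_I\, \mathbf{1}_I(x),\qquad \lambda_I:= \frac{|\Delta_I(vw^{2t})|}{\langle vw^{2t}\rangle_I}\,\frac{|\Delta_I(u^{-1})|}{\langle u^{-1}\rangle_I}\, \frac{|I|}{\langle w\rangle_I^t},$$ is bounded from $L^2(u)$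 into $L^2(v)$, with operator norm $C_4$. Moreover, with $C_2$ and $C_3$ denoting the best constants in (ii) and (iii), $$\sup_\sigma\|T^t_{w,\sigma} \|_{L^2(u)\to L^2(v)}\approx \sqrt{C_1} + \sqrt{C_2} +\sqrt{C_3}+ C_4 .$$
   Context: A weight is an almost everywhere positive, locally integrable function on $\mathbb{R}$; $L^2(u)$ is the space of measurable $f$ with $\|f\|_{L^2(u)}^2=\int_{\mathbb{R}}|f|^2u\,dx<\infty$. $\mathcal{D}$ is the set of standard dyadic intervals $[2^{-j}k,2^{-j}(k+1))$, $j,k\in\mathbb{Z}$. For $I\in\mathcal{D}$, $I_-$ and $I_+$ are its left and right halves, $|I|$ is its length, $\mathbf{1}_I$ its characteristic function, $\langle f\rangle_I=\frac{1}{|I|}\int_I f\,dx$ (with values in $[0,\infty]$ for nonnegative $f$), and $\Delta_I f=\langle f\rangle_{I_+}-\langle f\rangle_{I_-}$. Condition (i) in particular forces $u^{-1}$ and $vw^{2t}$ to be locally integrable, so the quantities in (ii)-(iv) make sense. The Haar function is $h_I=|I|^{-1/2}(\mathbf{1}_{I_+}-\mathbf{1}_{I_-})$, and $\langle f,g\rangle$ is the $L^2(\mathbb{R})$ inner product. A choice of signs is $\sigma=\{\sigma_I\}_{I\in\mathcal{D}}$ with $\sigma_I=\pm1$. The $t$-Haar multiplier is formally defined on locally integrable functions by $$T^t_{w,\sigma} f(x) = \sum_{I\in \mathcal{D}} \sigma_I\left (\frac{w(x)}{\langle w\rangle_I}\right )^t \langle f,h_I\rangle \,h_I(x).$$ Boundedness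 of this formal series is understood through finite sums, with bounds independent of the truncation: uniform boundedness in $\sigma$ means that there is a constant $C$ such that for every choice of signs $\sigma$, every finite $F\subset\mathcal{D}$, and every locally integrable $f\in L^2(u)$, the $L^2(v)$ norm of the sum restricted to $I\in F$ is at most $C\|f\|_{L^2(u)}$; $\sup_\sigma\|T^t_{w,\sigma}\|_{L^2(u)\to L^2(v)}$ is the least such $C$. $A\approx B$ means $c^{-1}A\le B\le cA$ for an absolute constant $c>0$. *)

(* Defs.v *)
From mathcomp Require Import all_boot all_order all_algebra finmap.
From mathcomp Require Import all_classical all_reals all_analysis.

Set Implicit Arguments.
Unset Strict Implicit.
Unset Printing Implicit Defensive.

Import Order.TTheory GRing.Theory Num.Theory.
Import numFieldNormedType.Exports.

Local Open Scope classical_set_scope.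
Local Open Scope ring_scope.

Definition weight (R : realType) (w : R -> R) : Prop :=
  locally_integrable [set: R] w /\
  (\forall x \ae (@lebesgue_measure R), 0 < w x).

(* [norm2 u f] is the norm of f in L^2(u), with value +oo if f is not in it. *)
Definition norm2 (R : realType) (u f : R -> R) : \bar R :=
  sqrte (\int[@lebesgue_measure R]_x (`|f x| ^+ 2 * u x)%:E)%E.

Definition in_L2 (R : realType) (u f : R -> R) : Prop :=
  measurable_fun [set: R] f /\ (norm2 u f < +oo)%E.

(* The index (j, k) stands for the interval [2^-j k, 2^-j (k + 1)[; this is a
   bijection between int * int and the standard dyadic intervals. *)
Definition dyadic : Type := (int * int)%type.

Definition dlen {R : realType} (I : dyadic) : R := (2 : R) ^ (- I.1).

Definition dset {R : realType} (I : dyadic) : set R :=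
  `[dlen I * I.2%:~R, dlen I * (I.2 + 1)%:~R[%classic.

Definition dleft (I : dyadic) : dyadic := (I.1 + 1, 2 * I.2).
Definition dright (I : dyadic) : dyadic := (I.1 + 1, 2 * I.2 + 1).

(* Average of f over I: [avge] takes the value +oo when f is nonnegative and
   not integrable on I; [avg] is meant for f integrable on I. *)
Definition avge (R : realType) (f : R -> R) (I : dyadic) : \bar R :=
  (((dlen I)^-1)%:E * \int[@lebesgue_measure R]_(x in dset I) (f x)%:E)%E.

Definition avg (R : realType) (f : R -> R) (I : dyadic) : R := fine (avge f I).

Definition Delta (R : realType) (f : R -> R) (I : dyadic) : R :=
  avg f (dright I) - avg f (dleft I).

Definition haar {R : realType} (I : dyadic) (x : R) : R :=
  (Num.sqrt (dlen I))^-1 *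
  (\1_(dset (dright I)) x - \1_(dset (dleft I)) x).

Definition inner (R : realType) (f g : R -> R) : R :=
  \int[@lebesgue_measure R]_x (f x * g x).

Definition signs (R : realType) (sigma : dyadic -> R) : Prop :=
  forall I, sigma I = 1 \/ sigma I = -1.

Definition haar_mult (R : realType) (w : R -> R) (t : R) (sigma : dyadic -> R)
    (F : {fset dyadic}) (f : R -> R) (x : R) : R :=
  \sum_(I <- F)
    sigma I * (w x / avg w I) `^ t * inner f (haar I) * haar I x.

Definition haar_mult_bound (R : realType) (u v w : R -> R) (t C : R) : Prop :=
  0 <= C /\
  forall (sigma : dyadic -> R) (F : {fset dyadic}) (f : R -> R),
    signs sigma -> locally_integrable [set: R] f -> in_L2 u f ->
    (norm2 v (haar_mult w t sigma F f) <= C%:E * norm2 u f)%E.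

Definition haar_mult_bounded (R : realType) (u v w : R -> R) (t : R) : Prop :=
  exists C : R, haar_mult_bound u v w t C.

(* The infimum below, and the other infima of constants, is +oo when no
   constant is admissible. *)
Definition haar_mult_norm (R : realType) (u v w : R -> R) (t : R) : \bar R :=
  ereal_inf [set C%:E | C in [set C : R | haar_mult_bound u v w t C]].

Definition winv (R : realType) (u : R -> R) : R -> R := fun x => (u x)^-1.

Definition vw2t (R : realType) (v w : R -> R) (t : R) : R -> R :=
  fun x => v x * w x `^ (2 * t).

Definition joint_const (R : realType) (u v w : R -> R) (t : R) : \bar R :=
  ereal_sup (range (fun I : dyadic =>
    avge (winv u) I * avge (vw2t v w t) I * ((avg w I `^ (2 * t))^-1)%:E)%E).

Definition carleson_bound (R : realType) (a b w : R -> R) (t C : R) : Prop :=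
  0 < C /\
  forall I : dyadic,
    (((dlen I)^-1)%:E *
       (\esum_(J in [set J : dyadic | (dset J : set R) `<=` dset I])
         (dlen J * `|Delta a J| ^+ 2 *
            (avg b J / avg w J `^ (2 * t)))%:E)
     <= (C * avg a I)%:E)%E.

Definition carleson (R : realType) (a b w : R -> R) (t : R) : Prop :=
  exists C : R, carleson_bound a b w t C.

Definition carleson_const (R : realType) (a b w : R -> R) (t : R) : \bar R :=
  ereal_inf [set C%:E | C in [set C : R | carleson_bound a b w t C]].

Definition lambda (R : realType) (u v w : R -> R) (t : R) (I : dyadic) : R :=
  `|Delta (vw2t v w t) I| / avg (vw2t v w t) I *
  (`|Delta (winv u) I| / avg (winv u) I) *
  (dlen I / avg w I `^ t).

Definition pos_term (R : realType) (u v w : R -> R) (t : R) (f : R -> R)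
    (x : R) (I : dyadic) : R :=
  w x `^ t / dlen I * lambda u v w t I * avg f I * \1_(dset I) x.

(* Sum of an unordered family, meaningful when the family is summable. *)
Definition pos_op (R : realType) (u v w : R -> R) (t : R) (f : R -> R) (x : R)
    : R :=
  let a := fun I => (pos_term u v w t f x I)%:E in
  fine (\esum_(I in [set: dyadic]) (a^\+)%E I
        - \esum_(I in [set: dyadic]) (a^\-)%E I)%E.

(* Part of boundedness is that, for f in L^2(u), the series defining the
   operator converges absolutely almost everywhere. *)
Definition pos_op_bound (R : realType) (u v w : R -> R) (t C : R) : Prop :=
  0 <= C /\
  forall f : R -> R, in_L2 u f ->
    (\forall x \ae (@lebesgue_measure R),
       summable [set: dyadic] (fun I => (pos_term u v w t f x I)%:E)) /\
    (norm2 v (pos_op u v w t f) <= C%:E * norm2 u f)%E.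

Definition pos_op_bounded (R : realType) (u v w : R -> R) (t : R) : Prop :=
  exists C : R, pos_op_bound u v w t C.

Definition pos_op_norm (R : realType) (u v w : R -> R) (t : R) : \bar R :=
  ereal_inf [set C%:E | C in [set C : R | pos_op_bound u v w t C]].

Definition approx_equiv (R : realType) (c : R) (A B : \bar R) : Prop :=
  ((c^-1)%:E * A <= B)%E /\ (B <= c%:E * A)%E.

(* Main.v *)
Require Import Defs.
From mathcomp Require Import all_boot all_order all_algebra finmap.
From mathcomp Require Import all_classical all_reals all_analysis.
From mathcomp Require Import measurable_realfun.
From mathcomp Require Import zify ring lra.

Set Implicit Arguments.
Unset Strict Implicit.
Unset Printing Implicit Defensive.

Import Order.TTheory GRing.Theory Num.Theory.
Import numFieldNormedType.Exports.

Local Open Scope classical_set_scope.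
Local Open Scope ring_scope.

(** Put a = 1/u, b = v w^(2t) and mu_I = <w>_I^(-t).  Since w(x)^t comes out of
    the multiplier and turns v into b, the square of the norm of the multiplier
    in L^2(v) is that of the sum of sigma_I mu_I <f, h_I> h_I in L^2(b), while
    u = 1/a.  By duality, and by choosing the signs, a bound uniform in the signs
    is the same, with the same constant, as the bound
      sum_I mu_I |<f, h_I>| |<g, h_I>| <= C ||f||_(L^2(1/a)) ||g||_(L^2(1/b))
    over finite families of intervals ([bilinear_of_haar_mult] and
    [haar_mult_of_bilinear]); it is symmetric in a and b, and the weight w
    survives in it only through the numbers mu_I.

    With A, F the integrals of a, f over I, and with a subscript + or - for
    integrals over the two halves, let e = F_-^2/A_- + F_+^2/A_+ - F^2/A, which
    is the square of the coefficient of f/a along the Haar function adapted to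
    a dx.  Elementary algebra gives
      | F_+ - F_- - ((A_+ - A_-)/A) F | <= sqrt(e A)    ([jump_decomposition]).
    The sum of e over a tree telescopes, which is Bessel's inequality, and the
    concave function X - F^2/(A + M) gives the Carleson embedding theorem in the
    same way, so that both are statements about finite trees of numbers
    ([bessel_tree], [carleson_tree1]).

    Sufficiency: inserting this splitting for f and for g, with b and B for g,
    yields four sums.  The first is bounded by the joint condition and Bessel,
    the two cross sums by the Carleson conditions through the embedding theorem,
    and the last is the bilinear form of the positive operator
    ([bilinear_bound_of_conditions]).

    Necessity: a truncation of a h_I as test function gives C_1 <= C^2
    ([joint_of_haar_mult]).  Signs can be chosen so that a signed sum has norm at
    least that of the square function ([exists_signs]), hence
    sum mu_I^2 <f, h_I>^2 <b>_I <= C^2 ||f||^2 ([square_function_bound]).  For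
    f = a 1_I this is the Carleson condition, with C_2 <= 4 C^2, and by symmetry
    C_3 <= 4 C^2.  The splitting, solved for the term with F, then bounds the
    bilinear form of the positive operator ([positive_bound_of_bilinear]), and a
    monotone limit over finite families gives C_4 <= 16 C
    ([pos_op_of_positive]).  The norm is therefore at most
    sqrt C_1 + sqrt C_2 + sqrt C_3 + C_4, which is at most 1 + 2 + 2 + 16 = 21
    times the norm.

    All this is done for weights that are positive everywhere; the quantities in
    the theorem do not change when the weights change on a null set. *)

Local Notation leb := (@lebesgue_measure _).

(** * Telescoping on finite dyadic trees *)

(** Satisfied by the integrals of a function over the dyadic intervals; the
    next lemmas are about arbitrary families of numbers with this property. *)
Definition splits (R : realType) (X : dyadic -> R) : Prop :=
  forall I, X I = X (dleft I) + X (dright I).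

Definition jump (R : realType) (X : dyadic -> R) (I : dyadic) : R :=
  X (dright I) - X (dleft I).

(** For A and X the integrals of a and of f over the intervals, this is the
    square of the coefficient of f/a along the function that is supported on I,
    constant on its halves, orthogonal to constants and normalized for a dx. *)
Definition energy (R : realType) (A X : dyadic -> R) (I : dyadic) : R :=
  X (dleft I) ^+ 2 / A (dleft I) + X (dright I) ^+ 2 / A (dright I)
  - X I ^+ 2 / A I.

(** The intervals of the first [n] generations below I, with I itself
    as generation 0. *)
Fixpoint descendants (n : nat) (I : dyadic) : seq dyadic :=
  if n is m.+1 then
    I :: descendants m (dleft I) ++ descendants m (dright I)
  else [::].

Lemma big_descendantsS (R : realType) n I (h : dyadic -> R) :
  \sum_(J <- descendants n.+1 I) h J =
  h I + \sum_(J <- descendants n (dleft I)) h J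
      + \sum_(J <- descendants n (dright I)) h J.
Proof. by rewrite big_cons big_cat /= addrA. Qed.

Lemma energy_ge0 (R : realType) (A X : dyadic -> R) :
  splits A -> splits X -> (forall I, 0 < A I) ->
  forall I, 0 <= energy A X I.
Proof.
move=> sA sX A0 I; rewrite /energy (sA I) (sX I).
have := A0 (dleft I); have := A0 (dright I).
move: (A (dleft I)) (A (dright I)) (X (dleft I)) (X (dright I)).
move=> q p x y p0 q0.
have p0' : p != 0 by rewrite gt_eqF.
have q0' : q != 0 by rewrite gt_eqF.
have pq0' : q + p != 0 by rewrite gt_eqF ?addr_gt0.
have -> : x ^+ 2 / q + y ^+ 2 / p - (x + y) ^+ 2 / (q + p) =
  (y * q - x * p) ^+ 2 / (q * p * (q + p)).
  by field; rewrite p0' q0' pq0'.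
by rewrite divr_ge0 ?sqr_ge0// !mulr_ge0 ?ltW ?addr_gt0.
Qed.

(** The unnormalized Haar function of I is a multiple of the one adapted
    to the measure A, plus a multiple of the indicator of I that restores the mean
    (A_+ - A_-)/A; the first multiple is at most the square root of A because
    4 A_- A_+ <= A^2. *)
Lemma jump_decomposition (R : realType) (A X : dyadic -> R) (I : dyadic) :
  splits A -> splits X -> (forall I, 0 < A I) ->
  `|jump X I - jump A I / A I * X I| <= Num.sqrt (energy A X I * A I).
Proof.
move=> sA sX A0; rewrite -[leLHS]ger0_norm ?normr_ge0// -sqrtr_sqr.
rewrite ler_wsqrtr// real_normK ?num_real//.
rewrite /energy /jump (sA I) (sX I).
have := A0 (dleft I); have := A0 (dright I).
move: (A (dleft I)) (A (dright I)) (X (dleft I)) (X (dright I)).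
move=> q p x y p0 q0.
have p0' : p != 0 by rewrite gt_eqF.
have q0' : q != 0 by rewrite gt_eqF.
have pq0' : q + p != 0 by rewrite gt_eqF ?addr_gt0.
rewrite -subr_ge0.
have -> : (x ^+ 2 / q + y ^+ 2 / p - (x + y) ^+ 2 / (q + p)) * (q + p) -
  (y - x - (p - q) / (q + p) * (x + y)) ^+ 2 =
  ((y * q - x * p) / (q + p)) ^+ 2 * (p - q) ^+ 2 / (p * q).
  by field; rewrite p0' q0' pq0'.
by rewrite divr_ge0 ?(mulr_ge0 (sqr_ge0 _) (sqr_ge0 _))// mulr_ge0 ?ltW.
Qed.

Lemma jump_le (R : realType) (A X : dyadic -> R) (I : dyadic) :
  splits A -> splits X -> (forall I, 0 < A I) ->
  `|jump X I| <= Num.sqrt (energy A X I * A I) + `|jump A I| / A I * `|X I|.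
Proof.
move=> sA sX A0; have := jump_decomposition I sA sX A0.
set z := jump A I / A I * X I => h.
have -> : `|jump A I| / A I * `|X I| = `|z|.
  by rewrite !normrM normfV (ger0_norm (ltW (A0 I))).
rewrite -[jump X I](subrK z); apply: (le_trans (ler_normD _ _)).
by rewrite lerD2r.
Qed.

(** The decomposition read backwards: it lets the bilinear form in the
    jumps of f control the one in the integrals of f. *)
Lemma jump_ge (R : realType) (A X : dyadic -> R) (I : dyadic) :
  splits A -> splits X -> (forall I, 0 < A I) ->
  `|jump A I| / A I * `|X I| <= `|jump X I| + Num.sqrt (energy A X I * A I).
Proof.
move=> sA sX A0; have := jump_decomposition I sA sX A0.
set z := jump A I / A I * X I => h.
have -> : `|jump A I| / A I * `|X I| = `|z|.
  by rewrite !normrM normfV (ger0_norm (ltW (A0 I))).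
rewrite -[z](subKr (jump X I)); apply: (le_trans (ler_normB _ _)).
by rewrite lerD2l.
Qed.

(** The energies telescope: their sum is the difference between the
    values of the sum of X^2/A over the last and over the first generation, and
    the former is at most the sum of Y over the last generation. *)
Lemma bessel_tree (R : realType) (A X Y : dyadic -> R) :
  splits A -> splits X -> splits Y -> (forall I, 0 < A I) ->
  (forall I, X I ^+ 2 / A I <= Y I) ->
  forall n I, \sum_(J <- descendants n I) energy A X J <= Y I - X I ^+ 2 / A I.
Proof.
move=> sA sX sY A0 XY; elim=> [|n IH] I; first by rewrite big_nil subr_ge0.
rewrite big_descendantsS (sY I).
have := IH (dleft I); have := IH (dright I); rewrite /energy; lra.
Qed.

(** Bellman function proof.  With M the sum of c below I, the function
    Y - X^2/(A + M) loses at least c (X/A)^2 / 4 when passing from I to its halves: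
    convexity of (X, S) |-> X^2/S handles the halves, whose values of A + M add up
    to A + M - c, and raising the denominator by c gains the rest since
    A + M <= 2 A. *)
Lemma carleson_tree1 (R : realType) (A X Y c : dyadic -> R) :
  splits A -> splits X -> splits Y -> (forall I, 0 < A I) ->
  (forall I, X I ^+ 2 / A I <= Y I) -> (forall I, 0 <= c I) ->
  (forall n I, \sum_(J <- descendants n I) c J <= A I) ->
  forall n I,
    \sum_(J <- descendants n I) c J * (X J / A J) ^+ 2 <=
    4 * (Y I - X I ^+ 2 / (A I + \sum_(J <- descendants n I) c J)).
Proof.
move=> sA sX sY A0 XY c0 cA; elim=> [|n IH] I.
  by rewrite !big_nil addr0 mulr_ge0// subr_ge0.
have := cA n.+1 I.
rewrite !big_descendantsS (sY I) (sX I) (sA I).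
have := IH (dleft I); have := IH (dright I).
have M0 K : 0 <= \sum_(J <- descendants n K) c J by rewrite sumr_ge0.
have := M0 (dleft I); have := M0 (dright I).
set S1 := \sum_(J <- _) c J; set S2 := \sum_(J <- _) c J.
set T1 := \sum_(J <- _) _ * _; set T2 := \sum_(J <- _) _ * _.
have := A0 (dleft I); have := A0 (dright I); have := c0 I.
move: S1 S2 T1 T2 (c I) (A (dright I)) (A (dleft I)) (X (dright I)).
move: (X (dleft I)) (Y (dright I)) (Y (dleft I)).
move=> y r s S1 S2 T1 T2 m p q x m0 p0 q0 S10 S20 h1 h2 h3.
set P := p + S1 in h1 *; set Q := q + S2 in h2 *.
have P0 : 0 < P by rewrite ltr_wpDr.
have Q0 : 0 < Q by rewrite ltr_wpDr.
have P0' : P != 0 by rewrite gt_eqF.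
have Q0' : Q != 0 by rewrite gt_eqF.
have PQ0 : 0 < Q + P := addr_gt0 Q0 P0.
have PQ0' : Q + P != 0 by rewrite gt_eqF.
have PQm0 : 0 < Q + P + m by rewrite ltr_wpDr.
have PQm0' : Q + P + m != 0 by rewrite gt_eqF.
have pq0 : 0 < q + p := addr_gt0 q0 p0.
have pq0' : q + p != 0 by rewrite gt_eqF.
(* Convexity of (X, S) |-> X^2/S. *)
have conv : (y + x) ^+ 2 / (Q + P) <= y ^+ 2 / Q + x ^+ 2 / P.
  rewrite -subr_ge0.
  have -> : y ^+ 2 / Q + x ^+ 2 / P - (y + x) ^+ 2 / (Q + P) =
    (x * Q - y * P) ^+ 2 / (Q * P * (Q + P)).
    by field; rewrite P0' Q0' PQ0'.
  by rewrite divr_ge0 ?sqr_ge0// (mulr_ge0 (ltW (mulr_gt0 _ _)) (ltW _)).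
(* The denominator A + M is larger by m = c_I than its value on the halves. *)
have gain : m * ((y + x) / (q + p)) ^+ 2 <=
    4 * ((y + x) ^+ 2 / (Q + P) - (y + x) ^+ 2 / (Q + P + m)).
  have -> : (y + x) ^+ 2 / (Q + P) - (y + x) ^+ 2 / (Q + P + m) =
    m * (y + x) ^+ 2 / ((Q + P) * (Q + P + m)).
    by field; rewrite PQ0' PQm0'.
  have hm : Q + P + m <= (q + p) * 2 by rewrite /P /Q; lra.
  have hM : (Q + P) * (Q + P + m) <= ((q + p) * 2) * ((q + p) * 2).
    apply: ler_pM => //; [exact: ltW| exact: ltW|].
    by apply: le_trans hm; rewrite lerDl.
  have inv : ((q + p) ^+ 2)^-1 <= 4 * ((Q + P) * (Q + P + m))^-1.
    rewrite -[leLHS]mul1r ler_pdivrMr ?exprn_gt0// mulrAC ler_pdivlMr ?mulr_gt0//.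
    by rewrite expr2; lra.
  have := ler_wpM2l (mulr_ge0 m0 (sqr_ge0 (y + x))) inv.
  by rewrite expr_div_n; lra.
have -> : q + p + (m + S2 + S1) = Q + P + m by rewrite /P /Q; ring.
lra.
Qed.

Lemma carleson_tree (R : realType) (A X Y c : dyadic -> R) (C : R) :
  splits A -> splits X -> splits Y -> (forall I, 0 < A I) ->
  (forall I, X I ^+ 2 / A I <= Y I) -> (forall I, 0 <= c I) -> 0 < C ->
  (forall n I, \sum_(J <- descendants n I) c J <= C * A I) ->
  forall n I,
    \sum_(J <- descendants n I) c J * (X J / A J) ^+ 2 <= 4 * C * Y I.
Proof.
move=> sA sX sY A0 XY c0 C0 cA n I.
have h n' I' : \sum_(J <- descendants n' I') c J / C <= A I'.
  by rewrite -mulr_suml ler_pdivrMr// mulrC cA.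
have c0' I' : 0 <= c I' / C by rewrite mulr_ge0 ?invr_ge0 ?(ltW C0)//.
have := carleson_tree1 sA sX sY A0 XY c0' h n I.
under eq_bigr do rewrite mulrAC.
rewrite -mulr_suml ler_pdivrMr// => /le_trans; apply.
set z := _ / _; have z0 : 0 <= z.
  apply: divr_ge0; first exact: sqr_ge0.
  by apply: addr_ge0; [exact: ltW|rewrite sumr_ge0].
rewrite -subr_ge0; clearbody z.
have -> : 4 * C * Y I - 4 * (Y I - z) * C = 4 * C * z by ring.
by rewrite !mulr_ge0// ltW.
Qed.

Lemma mem_descendants_level n I J : J \in descendants n I -> I.1 <= J.1.
Proof.
elim: n I => [//|n IH] I; rewrite inE mem_cat => /or3P[/eqP->//| |] /IH /=; lia.
Qed.

Lemma descendants_complete (m : nat) (n : nat) (j k l : int) : (m < n)%N ->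
  k * 2 ^+ m <= l < (k + 1) * 2 ^+ m -> (j + m%:Z, l) \in descendants n (j, k).
Proof.
elim: m n j k l => [|m IH] [|n] j k l //= mn.
  rewrite !mulr1 addr0 => kl; have -> : l = k by lia.
  by rewrite inE eqxx.
rewrite !exprS => kl; rewrite inE mem_cat; apply/orP; right.
have -> : j + m.+1 = (j + 1) + m by lia.
have [lt|ge] := ltP l ((2 * k + 1) * 2 ^+ m).
  apply/orP; left; apply: IH => //; move: lt kl.
  by move: (2 ^+ m) => e /=; nia.
apply/orP; right; apply: IH => //; move: ge kl.
by move: (2 ^+ m) => e /=; nia.
Qed.

(** No dyadic interval contains both positive and negative numbers, so
    two trees are needed: those rooted at [0, 2^N) and [-2^N, 0). *)
Lemma two_roots_cover (F : seq dyadic) :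
  exists n N : nat, {subset F <=
    descendants n (- N%:Z, 0) ++ descendants n (- N%:Z, -1)}.
Proof.
(* For j >= -N with |j| + |k| <= N, the level of (j, k) below the roots is
   j + N >= |k|, and 2^m > m puts the interval (j, k) below one of them. *)
pose N := (\sum_(I <- F) (`|I.1| + `|I.2|))%N.
exists (N + N).+1, N => -[j k] jkF.
have jkN : (`|j| + `|k| <= N)%N.
  by rewrite /N (big_rem _ jkF)/= leq_addr.
have [m mE] : exists m : nat, - N%:Z + m%:Z = j by exists (absz (j + N%:Z)); lia.
have mk : (`|k| <= m)%N by lia.
have k2 : (absz k)%:Z < 2 ^+ m.
  by rewrite -natrX natz ltz_nat (leq_ltn_trans mk (ltn_expl _ _)).
rewrite -mE mem_cat; apply/orP.
have [k0|k0] := leP 0 k; [left|right]; apply: descendants_complete.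
- by lia.
- by move: k2; move: (2 ^+ m) => e; lia.
- by lia.
- by move: k2; move: (2 ^+ m) => e; lia.
Qed.

Lemma ler_sum_uniq_sub (R : realType) (T : eqType) (s s' : seq T) (h : T -> R) :
  uniq s -> uniq s' -> {subset s <= s'} -> (forall x, 0 <= h x) ->
  \sum_(x <- s) h x <= \sum_(x <- s') h x.
Proof.
move=> us us' ss' h0; rewrite [leRHS](bigID (mem s))/= -[X in _ <= X + _]big_filter.
have ps : perm_eq [seq x <- s' | x \in s] s; last first.
  by rewrite (perm_big _ ps) lerDl sumr_ge0.
apply: uniq_perm => //; first by rewrite filter_uniq.
by move=> x; rewrite mem_filter; case: (boolP (x \in s)) => // /ss' ->.
Qed.

(** * Dyadic intervals of the line *)

Lemma dlen_gt0 (R : realType) (I : dyadic) : 0 < dlen I :> R.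
Proof. by rewrite /dlen exprz_gt0. Qed.

Lemma dlen_child (R : realType) (I J : dyadic) : J.1 = I.1 + 1 ->
  dlen J = dlen I / 2 :> R.
Proof. by move=> h; rewrite /dlen h opprD expfzDr// exprN1. Qed.

(** Stated in [measurableTypeR R], the measurable space that carries the
    Lebesgue measure, so that it can be passed to lemmas about integrals. *)
Lemma measurable_dset (R : realType) (I : dyadic) :
  measurable (dset I : set (measurableTypeR R)).
Proof. exact: measurable_itv. Qed.

Lemma lebesgue_measure_dset (R : realType) (I : dyadic) :
  lebesgue_measure (dset I : set R) = (dlen I)%:E.
Proof.
rewrite /dset lebesgue_measure_itv/= lte_fin ltr_pM2l ?dlen_gt0//.
by rewrite ltr_int ltrDl ltr01 -EFinB -mulrBr -rmorphB/= addrC addKr mulr1.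
Qed.

Lemma mem_dset (R : realType) (I : dyadic) (x : R) :
  dset I x = (dlen I * I.2%:~R <= x < dlen I * (I.2 + 1)%:~R) :> Prop.
Proof. by rewrite /dset /= in_itv. Qed.

Lemma dset_child (R : realType) (I : dyadic) (x : R) :
  (dset (dleft I) x =
     (dlen I * I.2%:~R <= x < dlen I * (I.2%:~R + 2^-1)) :> Prop) *
  (dset (dright I) x =
     (dlen I * (I.2%:~R + 2^-1) <= x < dlen I * (I.2 + 1)%:~R) :> Prop).
Proof.
rewrite !mem_dset (@dlen_child _ I (dleft I))// (@dlen_child _ I (dright I))//=.
rewrite !intrD !intrM /=.
have -> : dlen I / 2 * (2%:~R * I.2%:~R) = dlen I * I.2%:~R :> R by field.
have -> : dlen I / 2 * (2%:~R * I.2%:~R + 1%:~R) = dlen I * (I.2%:~R + 2^-1) :> R.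
  by field.
have -> : dlen I / 2 * (2%:~R * I.2%:~R + 1%:~R + 1%:~R) =
    dlen I * (I.2%:~R + 1%:~R) :> R by field.
by [].
Qed.

Lemma dset_split (R : realType) (I : dyadic) :
  dset I = dset (dleft I) `|` dset (dright I) :> set R.
Proof.
have := dlen_gt0 R I; rewrite predeqE => L0 x; rewrite /setU/= !dset_child mem_dset.
have h1 : dlen I * I.2%:~R <= dlen I * (I.2%:~R + 2^-1) :> R.
  by rewrite ler_pM2l//; lra.
have h2 : dlen I * (I.2%:~R + 2^-1) <= dlen I * (I.2 + 1)%:~R :> R.
  by rewrite ler_pM2l// intrD; lra.
split=> [/andP[x1 x2]|[/andP[x1 x2]|/andP[x1 x2]]].
- have [x3|x3] := ltP x (dlen I * (I.2%:~R + 2^-1)).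
    by left; apply/andP.
  by right; apply/andP.
- by apply/andP; split => //; exact: lt_le_trans x2 _.
- by apply/andP; split => //; exact: le_trans x1.
Qed.

Lemma dset_children_disjoint (R : realType) (I : dyadic) :
  [disjoint dset (dleft I) & (dset (dright I) : set R)].
Proof.
apply/disj_setPS => x []; rewrite !dset_child => /andP[_ x1] /andP[x2 _].
by have := le_lt_trans x2 x1; rewrite ltxx.
Qed.

Lemma dset_nonempty (R : realType) (I : dyadic) : (dset I : set R) !=set0.
Proof.
exists (dlen I * I.2%:~R); rewrite mem_dset lexx ltr_pM2l ?dlen_gt0//.
by rewrite ltr_int ltrDl.
Qed.

Lemma descendants_sub (R : realType) n I J :
  J \in descendants n I -> dset J `<=` (dset I : set R).
Proof.
elim: n I => [//|n IH] I; rewrite inE mem_cat => /or3P[/eqP->//| |] /IH JI.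
- by apply: subset_trans JI _; rewrite (dset_split R I); exact: subsetUl.
- by apply: subset_trans JI _; rewrite (dset_split R I); exact: subsetUr.
Qed.

Lemma descendants_disjoint (R : realType) n m I I' :
  [disjoint dset I & (dset I' : set R)] -> 
  forall J, J \in descendants n I -> J \in descendants m I' -> False.
Proof.
move=> /disj_setPS dII J /descendants_sub-/(_ R) JI /descendants_sub-/(_ R) JI'.
by have [x Jx] := dset_nonempty R J; apply: (dII x); split; [exact: JI|exact: JI'].
Qed.

Lemma descendants_uniq (R : realType) n I : uniq (descendants n I).
Proof.
elim: n I => [//|n IH] I /=; rewrite cat_uniq !IH mem_cat /= andbT.
apply/andP; split.
  by apply/negP => /orP[] /mem_descendants_level /=; lia.
apply/hasPn => J Jr; apply/negP => Jl.
exact: (descendants_disjoint (dset_children_disjoint R I) Jl Jr).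
Qed.

Lemma roots_disjoint (R : realType) (j : int) :
  [disjoint dset (j, 0) & (dset (j, -1) : set R)].
Proof.
apply/disj_setPS => x []; rewrite !mem_dset /dlen /= addNr mulr0.
by move=> /andP[x1 _] /andP[_ x2]; have := le_lt_trans x1 x2; rewrite ltxx.
Qed.

(** The roots exhaust the line, which makes integrability on dyadic
    intervals the same as local integrability. *)
Lemma roots_set (R : realType) (N : nat) :
  dset (- N%:Z, 0) `|` dset (- N%:Z, -1) = `[- 2 ^+ N, 2 ^+ N[%classic :> set R.
Proof.
rewrite predeqE => x; rewrite /setU /= !mem_dset in_itv /= /dlen /= opprK addNr.
rewrite add0r mulr0 mulr1 mulrN1 -exprnP.
have p0 : 0 < 2 ^+ N :> R by rewrite exprn_gt0.
split => [[/andP[x1 x2]|/andP[x1 x2]]|/andP[x1 x2]].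
- by apply/andP; split; lra.
- by apply/andP; split; lra.
- by have [x3|x3] := leP 0 x; [left|right]; rewrite ?x3 ?x2 ?x1.
Qed.

(** * Locally integrable functions and test functions *)

Definition locint (R : realType) (f : R -> R) : Prop :=
  locally_integrable [set: R] f.

Lemma locint_measurable (R : realType) (f : R -> R) :
  locint f -> measurable_fun [set: R] f.
Proof. by case. Qed.

Lemma locint_itv (R : realType) (f : R -> R) (a b : R) :
  locint f -> leb.-integrable `[a, b] (EFin \o f).
Proof.
case=> mf _ h; apply/integrableP; split.
  by apply/measurable_EFinP; apply: measurable_funTS.
by apply: h => //; exact: segment_compact.
Qed.

Lemma locint_dset (R : realType) (f : R -> R) (I : dyadic) :
  locint f -> leb.-integrable (dset I) (EFin \o f).
Proof.
move=> /(locint_itv (dlen I * I.2%:~R) (dlen I * (I.2 + 1)%:~R)).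
apply: integrableS => //; first exact: measurable_dset.
by move=> x; rewrite mem_dset /= in_itv/= => /andP[-> /ltW].
Qed.

(** A compact set lies in the union of two large dyadic
    intervals on either side of 0. *)
Lemma integrable_dsets_locint (R : realType) (f : R -> R) :
  measurable_fun [set: R] f ->
  (forall I, leb.-integrable (dset I) (EFin \o f)) -> locint f.
Proof.
move=> mf intf; split => // [|K _ cK]; first exact: openT.
have := compact_bounded cK => -[M [Mr KM]].
have [N MN] : exists N : nat, M < 2 ^+ N.
  have [N MN] : exists N : nat, M < N%:R.
    by exists (Num.bound `|M|); rewrite (le_lt_trans (ler_norm _))// archi_boundP.
  exists N; apply: (lt_le_trans MN); rewrite -natrX ler_nat.
  by rewrite ltnW// ltn_expl.
have [e e0 eE] : exists2 e, M < e & e < 2 ^+ N.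
  by exists ((M + 2 ^+ N) / 2); [rewrite midf_lt|rewrite midf_lt].
have Ksub : K `<=` dset (- N%:Z, 0) `|` dset (- N%:Z, -1).
  rewrite roots_set => x /(KM _ e0) /=; rewrite ler_norml in_itv/= => /andP[x1 x2].
  by apply/andP; split; [apply: le_trans x1; rewrite lerN2 ltW|exact: le_lt_trans eE].
have mK : measurable K by apply: closed_measurable; exact: compact_closed.
have mdd (I : dyadic) : measurable (dset I : set (measurableTypeR R)).
  exact: measurable_dset.
have mf' (D : set R) : measurable_fun D (fun x => `|f x|%:E).
  by apply/measurable_EFinP/measurable_funTS; exact: measurableT_comp.
have mU := measurableU _ _ (mdd (- N%:Z, 0)) (mdd (- N%:Z, -1)).
have sub := ge0_subset_integral leb mK mU (mf' _) _ Ksub.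
refine (le_lt_trans (sub _) _); first by move=> x _; rewrite lee_fin.
rewrite (ge0_integral_setU leb (mdd _) (mdd _) (mf' _) _ (roots_disjoint _ _)).
  by apply: lte_add_pinfty; have /integrableP[] := intf (- N%:Z, 0);
  have /integrableP[] := intf (- N%:Z, -1).
by move=> x _; rewrite lee_fin.
Qed.

(** Bounded functions with bounded support: products of these with
    locally integrable functions are integrable, and finite sums of Haar functions
    and of indicators are of this kind. *)
Definition test_function (R : realType) (k : R -> R) : Prop :=
  [/\ measurable_fun [set: R] k, exists M : R, forall x, `|k x| <= M
    & exists N : R, forall x, N < `|x| -> k x = 0].

Lemma testD (R : realType) (k l : R -> R) :
  test_function k -> test_function l -> test_function (fun x => k x + l x).
Proof.
move=> [mk [M kM] [N kN]] [ml [M' lM] [N' lN]]; split.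
- exact: measurable_funD.
- by exists (M + M') => x; apply: (le_trans (ler_normD _ _)); apply: lerD.
- by exists (Num.max N N') => x; rewrite gt_max => /andP[/kN-> /lN->]; rewrite addr0.
Qed.

Lemma testM (R : realType) (k l : R -> R) :
  test_function k -> test_function l -> test_function (fun x => k x * l x).
Proof.
move=> [mk [M kM] [N kN]] [ml [M' lM] _]; split.
- exact: measurable_funM.
- by exists (M * M') => x; rewrite normrM; apply: ler_pM.
- by exists N => x /kN->; rewrite mul0r.
Qed.

Lemma testZ (R : realType) (c : R) (k : R -> R) :
  test_function k -> test_function (fun x => c * k x).
Proof.
move=> [mk [M kM] [N kN]]; split.
- exact: measurable_funM.
- by exists (`|c| * M) => x; rewrite normrM; apply: ler_wpM2l.
- by exists N => x /kN->; rewrite mulr0.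
Qed.

Lemma test_sum (R : realType) (T : eqType) (s : seq T) (c : T -> R)
    (k : T -> R -> R) :
  (forall i, test_function (k i)) -> test_function (fun x => \sum_(i <- s) c i * k i x).
Proof.
move=> tk; elim: s => [|i s IH].
  under [X in test_function X]funext do rewrite big_nil.
  split; first exact: measurable_cst.
    by exists 0 => x; rewrite normr0.
  by exists 0.
under [X in test_function X]funext do rewrite big_cons.
by apply: testD IH; exact: testZ.
Qed.

Lemma test_indic (R : realType) (I : dyadic) : test_function (\1_(dset I) : R -> R).
Proof.
split.
- by apply: measurable_indic; exact: measurable_dset.
- by exists 1 => x; rewrite indicE; case: (_ \in _) => /=; rewrite ?normr1 ?normr0.
- exists (`|dlen I * I.2%:~R| + `|dlen I * (I.2 + 1)%:~R|) => x xN.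
  rewrite indicE memNset// mem_dset => /andP[x1 x2].
  suff : `|x| <= `|dlen I * I.2%:~R| + `|dlen I * (I.2 + 1)%:~R|.
    by rewrite leNgt xN.
  move: x1 x2 {xN}; move: (dlen I * I.2%:~R) (dlen I * (I.2 + 1)%:~R) => p q px xq.
  have := ler_norm q; have := ler_norm (- p); have := normr_ge0 p.
  have := normr_ge0 q; rewrite normrN ler_norml.
  by move=> ? ? ? ?; apply/andP; split; lra.
Qed.

Lemma test_haar (R : realType) (I : dyadic) : test_function (haar I : R -> R).
Proof.
apply: testZ; apply: testD (test_indic _ _) _.
under [X in test_function X]funext do rewrite -mulN1r.
exact/testZ/test_indic.
Qed.

Lemma test_integrable (R : realType) (k f : R -> R) :
  test_function k -> locint f -> leb.-integrable [set: R] (EFin \o (fun x => k x * f x)).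
Proof.
move=> [mk [M kM] [N kN]] lf.
have mI : measurable (`[- N, N]%classic : set R) by exact: measurable_itv.
have -> : EFin \o (fun x => k x * f x) =
    (((EFin \o k) \* (EFin \o f))%E \_ (`[- N, N]%classic : set R)).
  apply/funext => x; rewrite patchE /=; case: ifPn => //.
  rewrite notin_setE /= in_itv /= => /negP; rewrite -ler_norml -ltNge => /kN ->.
  by rewrite mul0r.
refine (proj1 (integrable_mkcond (mu:=leb) _ mI) _).
apply: integrableMr => //; [exact: measurable_funTS| |exact: locint_itv].
exists M; split; first exact: num_real.
by move=> y My x _; exact: le_trans (kM x) (ltW My).
Qed.

Lemma test_locint (R : realType) (k f : R -> R) :
  test_function k -> locint f -> locint (fun x => k x * f x).
Proof.
move=> tk lf; apply: open_integrable_locally; first exact: openT.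
exact: test_integrable.
Qed.

Lemma locint1 (R : realType) : locint (fun=> 1 : R).
Proof.
have := @locally_integrable_indic R [set: R] [set: R] openT measurableT.
by rewrite indicT.
Qed.

(** * Integrals over dyadic intervals and the Cauchy-Schwarz inequality *)

Definition mass (R : realType) (f : R -> R) (I : dyadic) : R :=
  \int[@lebesgue_measure R]_(x in dset I) f x.

Lemma mass_splits (R : realType) (f : R -> R) : locint f -> splits (mass f).
Proof.
move=> lf I; rewrite /mass (dset_split R I) Rintegral_setU//.
- exact: measurable_dset.
- exact: measurable_dset.
- by rewrite -dset_split; exact: locint_dset.
- exact: dset_children_disjoint.
Qed.

(** Holds for every f: an infinite integral has [fine] value 0 on both sides. *)
Lemma avgE (R : realType) (f : R -> R) (I : dyadic) :
  avg f I = mass f I / dlen I.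
Proof.
rewrite /avg /avge /mass /Rintegral mulrC.
have L0 : 0 < (dlen I)^-1 :> R by rewrite invr_gt0 dlen_gt0.
case: (\int[_]_(_ in _) _)%E => [r| |]//=.
  by rewrite mulry gtr0_sg// mul1e mulr0.
by rewrite mulrNy gtr0_sg// mul1e mulr0.
Qed.

Lemma DeltaE (R : realType) (f : R -> R) (I : dyadic) :
  Delta f I = 2 * jump (mass f) I / dlen I.
Proof.
rewrite /Delta !avgE /jump (@dlen_child _ I (dleft I))// (@dlen_child _ I (dright I))//.
have L0 : dlen I != 0 :> R by rewrite gt_eqF ?dlen_gt0.
by field.
Qed.

Lemma measurable_EFin (R : realType) (f : R -> R) (D : set R) :
  measurable_fun [set: R] f -> measurable_fun D (EFin \o f).
Proof. by move=> mf; apply/measurable_EFinP/measurable_funTS. Qed.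

Lemma integral_dset_gt0 (R : realType) (f : R -> R) (I : dyadic) :
  measurable_fun [set: R] f -> (forall x, 0 < f x) ->
  (0 < \int[@lebesgue_measure R]_(x in dset I) (f x)%:E)%E.
Proof.
move=> mf f0; rewrite lt_neqAle integral_ge0 ?andbT; last first.
  by move=> x _; rewrite lee_fin ltW.
apply/negP => /eqP i0.
have mI : measurable (dset I : set (measurableTypeR R)) by exact: measurable_dset.
have : ae_eq leb (dset I) (EFin \o f) (cst 0%E).
  refine (proj1 (ae_eq_integral_abs leb mI (measurable_EFin mf)) _).
  rewrite [RHS]i0; apply: eq_integral => x _ /=.
  by rewrite ger0_norm// ltW.
move=> [N [mN N0 sN]].
have IN : dset I `<=` N.
  apply: subset_trans sN => x Ix /= /(_ Ix) [] fx0.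
  by have := f0 x; rewrite fx0 ltxx.
have : (leb (dset I : set R) <= 0)%E.
  by rewrite -N0; refine (le_measure leb (mem_set mI) (mem_set mN) IN).
rewrite lebesgue_measure_dset lee_fin leNgt.
by rewrite dlen_gt0.
Qed.

Lemma mass_gt0 (R : realType) (f : R -> R) (I : dyadic) :
  locint f -> (forall x, 0 < f x) -> 0 < mass f I.
Proof.
move=> lf f0; have := integral_dset_gt0 I (locint_measurable lf) f0.
rewrite /mass /Rintegral.
have := integrable_fin_num (@measurable_dset R I) (locint_dset I lf).
by case: (\int[_]_(_ in _) _)%E.
Qed.

Lemma Rintegral_indic (R : realType) (f : R -> R) (I : dyadic) :
  \int[@lebesgue_measure R]_x (\1_(dset I) x * f x) = mass f I.
Proof.
rewrite /mass [RHS]Rintegral_mkcond; apply: eq_Rintegral => x _.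
by rewrite patchE indicE; case: (x \in dset I); rewrite ?mul1r ?mul0r.
Qed.

Lemma inner_haar (R : realType) (f : R -> R) (I : dyadic) : locint f ->
  inner f (haar I) = jump (mass f) I / Num.sqrt (dlen I).
Proof.
move=> lf; rewrite /inner /jump -!Rintegral_indic.
have i1 J := test_integrable (test_indic R J) lf.
rewrite -RintegralB// -RintegralZr//; last first.
  have := integrableB measurableT (i1 (dright I)) (i1 (dleft I)).
  by apply: eq_integrable.
by apply: eq_Rintegral => x _; rewrite /haar; ring.
Qed.

Lemma integral_haar (R : realType) (f : R -> R) (I : dyadic) :
  \int[@lebesgue_measure R]_x (haar I x * f x) = inner f (haar I).
Proof. by apply: eq_Rintegral => x _; rewrite mulrC. Qed.

Lemma Rintegral_test_sum (R : realType) (T : eqType) (s : seq T) (c : T -> R)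
    (k : T -> R -> R) (f : R -> R) :
  (forall i, test_function (k i)) -> locint f ->
  \int[@lebesgue_measure R]_x ((\sum_(i <- s) c i * k i x) * f x) =
  \sum_(i <- s) c i * \int[@lebesgue_measure R]_x (k i x * f x).
Proof.
move=> tk lf; elim: s => [|i s IH].
  rewrite big_nil; under eq_Rintegral do rewrite big_nil mul0r.
  by rewrite Rintegral_cst// mul0r.
rewrite big_cons -IH -RintegralZl//; last exact: test_integrable.
rewrite -RintegralD//.
- by apply: eq_Rintegral => x _; rewrite big_cons; ring.
- have := test_integrable (testZ (c i) (tk i)) lf.
  by apply: eq_integrable => // x _; rewrite /= mulrA.
- by apply: test_integrable => //; exact: test_sum.
Qed.

Definition L2 (R : realType) (u f : R -> R) : Prop :=
  measurable_fun [set: R] f /\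
  (@lebesgue_measure R).-integrable [set: R] (EFin \o (fun x => f x ^+ 2 * u x)).

Definition sqnorm (R : realType) (u f : R -> R) : R :=
  \int[@lebesgue_measure R]_x (f x ^+ 2 * u x).

(** In this form L^2(u) is paired with L^2(1/u) by the unweighted
    integral.  The proof is the discriminant of the quadratic form
    s, t |-> integral of (s f u - t g)^2 / u. *)
Lemma cauchy_schwarz (R : realType) (u f g : R -> R) (D : set (measurableTypeR R)) :
  measurable D -> (forall x, 0 < u x) ->
  measurable_fun [set: R] f -> measurable_fun [set: R] g ->
  leb.-integrable D (EFin \o (fun x => f x ^+ 2 * u x)) ->
  leb.-integrable D (EFin \o (fun x => g x ^+ 2 / u x)) ->
  leb.-integrable D (EFin \o (fun x => f x * g x)) /\
  (\int[leb]_(x in D) (f x * g x)) ^+ 2 <=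
  (\int[leb]_(x in D) (f x ^+ 2 * u x)) * (\int[leb]_(x in D) (g x ^+ 2 / u x)).
Proof.
move=> mD u0 mf mg if2 ig2.
have ifg : leb.-integrable D (EFin \o (fun x => f x * g x)).
  have := integrableD mD if2 ig2; apply: le_integrable => //.
    by apply: measurable_EFin; exact: measurable_funM.
  move=> x _; rewrite /= lee_fin -[X in _ <= X]/(`|f x ^+ 2 * u x + g x ^+ 2 / u x|).
  have ux := u0 x.
  have p1 : 0 <= f x ^+ 2 * u x by rewrite mulr_ge0 ?sqr_ge0// ltW.
  have p2 : 0 <= g x ^+ 2 / u x by rewrite divr_ge0 ?sqr_ge0// ltW.
  rewrite [leRHS]ger0_norm ?addr_ge0//.
  have h1 : 0 <= (f x * u x - g x) ^+ 2 / u x by rewrite divr_ge0 ?sqr_ge0// ltW.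
  have h2 : 0 <= (f x * u x + g x) ^+ 2 / u x by rewrite divr_ge0 ?sqr_ge0// ltW.
  have ux' : u x != 0 by rewrite gt_eqF.
  have e1 : (f x * u x - g x) ^+ 2 / u x =
    f x ^+ 2 * u x + g x ^+ 2 / u x - 2 * (f x * g x) by field.
  have e2 : (f x * u x + g x) ^+ 2 / u x =
    f x ^+ 2 * u x + g x ^+ 2 / u x + 2 * (f x * g x) by field.
  rewrite ler_norml; rewrite e1 in h1; rewrite e2 in h2.
  by apply/andP; split; lra.
split => //.
set a := \int[leb]_(x in D) (f x ^+ 2 * u x).
set b := \int[leb]_(x in D) (g x ^+ 2 / u x).
set c := \int[leb]_(x in D) (f x * g x).
have a0 : 0 <= a.
  by apply: Rintegral_ge0 => x _; rewrite mulr_ge0 ?sqr_ge0// ltW.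
have b0 : 0 <= b.
  by apply: Rintegral_ge0 => x _; rewrite divr_ge0 ?sqr_ge0// ltW.
have key s t : 0 <= s ^+ 2 * a - 2 * s * t * c + t ^+ 2 * b.
  have -> : s ^+ 2 * a - 2 * s * t * c + t ^+ 2 * b =
    \int[leb]_(x in D) ((s * (f x * u x) - t * g x) ^+ 2 / u x).
    have ih1 := integrableZl mD (s ^+ 2) if2.
    have ih2 := integrableZl mD (2 * s * t) ifg.
    have ih3 := integrableZl mD (t ^+ 2) ig2.
    rewrite /a /b /c -!RintegralZl// -RintegralB// -RintegralD//; last first.
      by have := integrableB mD ih1 ih2; apply: eq_integrable.
    apply: eq_Rintegral => x _.
    have ux' : u x != 0 by rewrite gt_eqF.
    by field.
  by apply: Rintegral_ge0 => x _; rewrite divr_ge0 ?sqr_ge0// ltW.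
have [b00|bp] := eqVneq b 0.
  (* For b = 0 the choice s = b, t = c used below gives nothing; t = 1 and s a
     small multiple of c force c = 0. *)
  have := key (c * (1 + a)^-1) (1 : R); rewrite b00.
  have a1 : 0 < 1 + a by rewrite ltr_wpDr.
  have a1' : 1 + a != 0 by rewrite gt_eqF.
  have -> : (c / (1 + a)) ^+ 2 * a - 2 * (c / (1 + a)) * 1 * c + 1 ^+ 2 * 0 =
    - (c ^+ 2 * (a + 2) / (1 + a) ^+ 2) by field.
  have a2 : 0 < a + 2 by rewrite ltr_wpDl.
  by rewrite oppr_ge0 ler_pdivrMr ?exprn_gt0// mul0r pmulr_lle0// mulr0.
have := key b c.
have -> : b ^+ 2 * a - 2 * b * c * c + c ^+ 2 * b = b * (a * b - c ^+ 2) by ring.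
by rewrite pmulr_rge0 ?subr_ge0// lt_neqAle eq_sym bp.
Qed.

(** * Weighted Bessel inequality and Carleson embedding *)

Lemma integrable_locint (R : realType) (f : R -> R) :
  (@lebesgue_measure R).-integrable [set: R] (EFin \o f) -> locint f.
Proof. exact: (open_integrable_locally openT). Qed.

Lemma sqnorm_ge0 (R : realType) (u f : R -> R) :
  (forall x, 0 < u x) -> 0 <= sqnorm u f.
Proof.
by move=> u0; apply: Rintegral_ge0 => x _; rewrite mulr_ge0 ?sqr_ge0// ltW.
Qed.

Lemma mass_roots_le (R : realType) (f : R -> R) (N : nat) :
  (@lebesgue_measure R).-integrable [set: R] (EFin \o f) ->
  (forall x, 0 <= f x) ->
  mass f (- N%:Z, 0) + mass f (- N%:Z, -1) <= \int[@lebesgue_measure R]_x f x.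
Proof.
move=> intf f0; have lf := integrable_locint intf.
rewrite -!Rintegral_indic -RintegralD//; last 2 first.
- by apply: test_integrable => //; exact: test_indic.
- by apply: test_integrable => //; exact: test_indic.
apply: le_Rintegral => //.
  have tI J := test_integrable (test_indic R J) lf.
  by have := integrableD measurableT (tI (- N%:Z, 0)) (tI (- N%:Z, -1));
    apply: eq_integrable.
move=> x _; rewrite -mulrDl ler_piMl// !indicE.
have /disj_setPS d := roots_disjoint R (- N%:Z).
have [/set_mem x1|_] := boolP (x \in dset (- N%:Z, 0)).
  rewrite memNset ?addr0// => x2; exact: (d x).
by case: (_ \in _); rewrite add0r//= ler01.
Qed.

(** Passes from trees to arbitrary finite families: such a family lies in
    two trees with disjoint roots. *)
Lemma sum_le_of_trees (R : realType) (f : R -> R) (h : dyadic -> R) (C : R)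
    (F : seq dyadic) :
  leb.-integrable [set: R] (EFin \o f) -> (forall x, 0 <= f x) ->
  (forall I, 0 <= h I) -> 0 <= C ->
  (forall n I, \sum_(J <- descendants n I) h J <= C * mass f I) ->
  uniq F -> \sum_(J <- F) h J <= C * \int[leb]_x f x.
Proof.
move=> intf f0 h0 C0 hC uF.
have [n [N FN]] := two_roots_cover F.
have uR : uniq (descendants n (- N%:Z, 0) ++ descendants n (- N%:Z, -1)).
  rewrite cat_uniq !(descendants_uniq R) andbT /=.
  apply/hasPn => J Jr; apply/negP => Jl.
  exact: (descendants_disjoint (roots_disjoint R _) Jl Jr).
apply: (le_trans (ler_sum_uniq_sub uF uR FN h0)).
rewrite big_cat; apply: (le_trans (lerD (hC _ _) (hC _ _))).
by rewrite -mulrDr ler_wpM2l// mass_roots_le.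
Qed.

Lemma winv_gt0 (R : realType) (a : R -> R) :
  (forall x, 0 < a x) -> forall x, 0 < winv a x.
Proof. by move=> a0 x; rewrite invr_gt0. Qed.

(** Cauchy-Schwarz against the constant 1, whose square has integral
    A over I for the weight 1/(1/a). *)
Lemma mass_sqr_le (R : realType) (a f : R -> R) : (forall x, 0 < a x) ->
  locint a -> L2 (winv a) f -> locint f /\
  forall I, mass f I ^+ 2 <= mass (fun x => f x ^+ 2 * winv a x) I * mass a I.
Proof.
move=> a0 la [mf intf].
have ii I : leb.-integrable (dset I) (EFin \o (fun x => f x ^+ 2 * winv a x)).
  by apply: integrableS intf => //; exact: measurable_dset.
have ia I : leb.-integrable (dset I) (EFin \o (fun x : R => 1 ^+ 2 / winv a x)).
  have := locint_dset I la; apply: eq_integrable; first exact: measurable_dset.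
  by move=> x _; rewrite /= /winv invrK expr1n mul1r.
have cs I := cauchy_schwarz (@measurable_dset R I) (winv_gt0 a0) mf
  (measurable_cst (1 : R)) (ii I) (ia I).
split.
  apply: integrable_dsets_locint => // I; have [+ _] := cs I.
  by apply: eq_integrable; [exact: measurable_dset|move=> x _; rewrite /= mulr1].
move=> I; have [_] := cs I.
have -> : \int[leb]_(x in dset I) (1 ^+ 2 / winv a x) = mass a I.
  by apply: eq_Rintegral => x _; rewrite /winv invrK expr1n mul1r.
have -> // : \int[leb]_(x in dset I) (f x * 1) = mass f I.
by apply: eq_Rintegral => x _; rewrite mulr1.
Qed.

Lemma sqr_mass_div_le (R : realType) (a f : R -> R) : (forall x, 0 < a x) ->
  locint a -> L2 (winv a) f ->
  forall I, mass f I ^+ 2 / mass a I <= mass (fun x => f x ^+ 2 * winv a x) I.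
Proof.
move=> a0 la Lf I; have [_ fI] := mass_sqr_le a0 la Lf.
by rewrite ler_pdivrMr ?mass_gt0.
Qed.

Lemma bessel (R : realType) (a f : R -> R) (F : seq dyadic) :
  (forall x, 0 < a x) -> locint a -> L2 (winv a) f -> uniq F ->
  \sum_(I <- F) energy (mass a) (mass f) I <= sqnorm (winv a) f.
Proof.
move=> a0 la Lf uF.
have [lf _] := mass_sqr_le a0 la Lf.
have sa := mass_splits la; have sf := mass_splits lf.
have a0' I := mass_gt0 I la a0.
rewrite -[leRHS]mul1r; apply: sum_le_of_trees => //.
- exact: Lf.2.
- by move=> x; rewrite mulr_ge0 ?sqr_ge0// ltW ?winv_gt0.
- exact: energy_ge0.
move=> n I; rewrite mul1r.
apply: (le_trans (bessel_tree sa sf _ a0' (sqr_mass_div_le a0 la Lf) n I)).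
  by apply: mass_splits; apply: integrable_locint; exact: Lf.2.
by rewrite gerBl divr_ge0 ?sqr_ge0// ltW.
Qed.

Lemma carleson_embedding (R : realType) (a f : R -> R) (c : dyadic -> R)
    (C : R) (F : seq dyadic) :
  (forall x, 0 < a x) -> locint a -> L2 (winv a) f -> uniq F ->
  (forall I, 0 <= c I) -> 0 < C ->
  (forall n I, \sum_(J <- descendants n I) c J <= C * mass a I) ->
  \sum_(I <- F) c I * (mass f I / mass a I) ^+ 2 <= 4 * C * sqnorm (winv a) f.
Proof.
move=> a0 la Lf uF c0 C0 cC.
have [lf _] := mass_sqr_le a0 la Lf.
have sa := mass_splits la; have sf := mass_splits lf.
have a0' I := mass_gt0 I la a0.
apply: sum_le_of_trees => //.
- exact: Lf.2.
- by move=> x; rewrite mulr_ge0 ?sqr_ge0// ltW ?winv_gt0.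
- by move=> I; rewrite mulr_ge0// sqr_ge0.
- by rewrite mulr_ge0// ltW.
move=> n I.
apply: (carleson_tree sa sf _ a0' (sqr_mass_div_le a0 la Lf) c0 C0 cC).
by apply: mass_splits; apply: integrable_locint; exact: Lf.2.
Qed.

(** * The bilinear form, choices of signs and the square function *)

(** Up to the factor |I|^(1/2), the jump of the integrals of f is the Haar
    coefficient of f, so the left-hand side is the sum of
    mu_I |<f, h_I>| |<h, h_I>|.  Writing the two spaces as L^2(1/a) and
    L^2(1/b) makes the condition symmetric in a and b. *)
Definition bilinear_bound (R : realType) (a b : R -> R) (mu : dyadic -> R)
    (C : R) : Prop :=
  forall (F : seq dyadic) (f h : R -> R),
    uniq F -> L2 (winv a) f -> L2 (winv b) h ->
    \sum_(I <- F) mu I * `|jump (mass f) I| * `|jump (mass h) I| / dlen I <=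
    C * Num.sqrt (sqnorm (winv a) f) * Num.sqrt (sqnorm (winv b) h).

Lemma bilinear_boundC (R : realType) (a b : R -> R) (mu : dyadic -> R) (C : R) :
  bilinear_bound a b mu C -> bilinear_bound b a mu C.
Proof.
move=> H F f h uF Lf Lh; have := H F h f uF Lh Lf.
rewrite mulrAC; apply: le_trans.
rewrite le_eqVlt; apply/orP; left; apply/eqP/eq_bigr => I _.
by rewrite -(mulrA (mu I)) [in LHS](mulrC `|_|) mulrA.
Qed.

Definition haar_sum (R : realType) (F : seq dyadic) (c : dyadic -> R) (x : R) :=
  \sum_(I <- F) c I * haar I x.

Lemma test_haar_sum (R : realType) (F : seq dyadic) (c : dyadic -> R) :
  test_function (haar_sum F c).
Proof. exact/test_sum/test_haar. Qed.

Lemma test_mul_L2 (R : realType) (b k : R -> R) :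
  (forall x, 0 < b x) -> locint b -> test_function k ->
  L2 (winv b) (fun x => k x * b x) /\
  sqnorm (winv b) (fun x => k x * b x) = \int[leb]_x (k x ^+ 2 * b x).
Proof.
move=> b0 lb tk.
have e x : (k x * b x) ^+ 2 * winv b x = k x ^+ 2 * b x.
  by have bx : b x != 0 := lt0r_neq0 (b0 x); rewrite /winv; field.
split; last by apply: eq_Rintegral => x _; exact: e.
split.
  by apply: measurable_funM; [case: tk|exact: locint_measurable].
have := test_integrable (testM tk tk) lb.
by apply: eq_integrable => // x _ /=; rewrite e expr2.
Qed.

Lemma integral_haar_sum (R : realType) (F : seq dyadic) (c : dyadic -> R)
    (h : R -> R) : locint h ->
  \int[leb]_x (haar_sum F c x * h x) =
  \sum_(I <- F) c I * (jump (mass h) I / Num.sqrt (dlen I)).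
Proof.
move=> lh; rewrite (Rintegral_test_sum _ _ (test_haar R) lh).
by apply: eq_bigr => I _; rewrite integral_haar inner_haar.
Qed.

Lemma le_sqr_of_le_mul_sqrt (R : rcfType) (N X : R) :
  0 <= N -> 0 <= X -> N <= X * Num.sqrt N -> N <= X ^+ 2.
Proof.
move=> N0 X0; have := sqr_sqrtr N0; have := sqrtr_ge0 N.
move: (Num.sqrt N) => s s0 <- h.
have [->|sn] := eqVneq s 0; first by rewrite expr0n sqr_ge0.
have sp : 0 < s by rewrite lt_neqAle eq_sym sn.
by move: h; rewrite expr2 ler_pM2r// => h; apply: ler_pM.
Qed.

Lemma haar_sum_sqr (R : realType) (F : seq dyadic) (c : dyadic -> R)
    (b : R -> R) : locint b ->
  \int[leb]_x (haar_sum F c x ^+ 2 * b x) =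
  \sum_(I <- F) c I *
    (jump (mass (fun x => haar_sum F c x * b x)) I / Num.sqrt (dlen I)).
Proof.
move=> lb; rewrite -integral_haar_sum; last first.
  by apply: test_locint => //; exact: test_haar_sum.
by apply: eq_Rintegral => x _; rewrite mulrA expr2.
Qed.

(** Duality: test the bilinear bound with h = k b, k being the multiplier
    sum itself, so that the pairing returns the square of its norm in L^2(b). *)
Lemma multiplier_bound (R : realType) (a b : R -> R) (mu : dyadic -> R) (C : R)
    (F : seq dyadic) (f : R -> R) (sigma : dyadic -> R) :
  (forall x, 0 < a x) -> (forall x, 0 < b x) -> locint b -> (forall I, 0 <= mu I) ->
  0 <= C -> bilinear_bound a b mu C -> uniq F -> L2 (winv a) f -> signs sigma ->
  \int[leb]_x (haar_sum F (fun I =>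
      sigma I * (mu I * (jump (mass f) I / Num.sqrt (dlen I)))) x ^+ 2 * b x) <=
  C ^+ 2 * sqnorm (winv a) f.
Proof.
move=> a0 b0 lb mu0 C0 H uF Lf sg.
pose c I := sigma I * (mu I * (jump (mass f) I / Num.sqrt (dlen I))).
rewrite -/c.
have [Lk Nk] := test_mul_L2 b0 lb (test_haar_sum F c).
have /= := H F _ _ uF Lf Lk; rewrite Nk.
set N := \int[leb]_x _ => h.
have N0 : 0 <= N by apply: Rintegral_ge0 => x _; rewrite mulr_ge0 ?sqr_ge0// ltW.
have S0 := sqnorm_ge0 f (winv_gt0 a0).
rewrite -(sqr_sqrtr S0) -exprMn; apply: le_sqr_of_le_mul_sqrt => //.
  by rewrite mulr_ge0// sqrtr_ge0.
apply: le_trans h; rewrite {1}/N haar_sum_sqr//; apply: ler_sum => I _.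
have L0 := dlen_gt0 R I.
apply: (le_trans (ler_norm _)).
rewrite /c !normrM !normfV (ger0_norm (mu0 I)) (ger0_norm (sqrtr_ge0 _)).
have -> : `|sigma I| = 1 by case: (sg I) => ->; rewrite ?normrN normr1.
rewrite mul1r -[X in _ <= _ / X](sqr_sqrtr (ltW L0)).
have s0 : Num.sqrt (dlen I) != 0 :> R by rewrite gt_eqF// sqrtr_gt0.
rewrite le_eqVlt; apply/orP; left; apply/eqP; move: s0; move: (Num.sqrt _) => s s0.
by field.
Qed.

Lemma haar_sqr (R : realType) (I : dyadic) (x : R) :
  haar I x ^+ 2 = (dlen I)^-1 * \1_(dset I) x.
Proof.
rewrite /haar exprMn exprVn sqr_sqrtr ?(ltW (dlen_gt0 _ _))//; congr (_ * _).
rewrite !indicE (dset_split R I) in_setU.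
have /disj_setPS d := dset_children_disjoint R I.
have [/set_mem x1|_] := boolP (x \in dset (dleft I)).
  rewrite memNset; last by move=> x2; exact: (d x).
  by rewrite /= sub0r sqrrN expr1n.
by case: (_ \in _); rewrite /= subr0 ?expr1n ?expr0n.
Qed.

Lemma haar_sqr_mass (R : realType) (I : dyadic) (b : R -> R) : locint b ->
  \int[leb]_x (haar I x ^+ 2 * b x) = mass b I / dlen I.
Proof.
move=> lb; rewrite -Rintegral_indic -RintegralZr//; last first.
  by apply: test_integrable => //; exact: test_indic.
by apply: eq_Rintegral => x _; rewrite haar_sqr; ring.
Qed.

(** Random signs give equality on average.  Here they are chosen one at
    a time so that no cross term is negative. *)
Lemma exists_signs (R : realType) (F : seq dyadic) (c : dyadic -> R)
    (b : R -> R) :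
  (forall x, 0 < b x) -> locint b -> uniq F ->
  exists2 sigma : dyadic -> R, signs sigma &
  \sum_(I <- F) c I ^+ 2 * (mass b I / dlen I) <=
  \int[leb]_x (haar_sum F (fun I => sigma I * c I) x ^+ 2 * b x).
Proof.
move=> b0 lb; elim: F => [|I F IH] /=.
  move=> _; exists (fun=> 1); first by left.
  rewrite big_nil; apply: Rintegral_ge0 => x _.
  by rewrite mulr_ge0 ?sqr_ge0// ltW.
move=> /andP[IF /IH[sigma sg le]].
pose k := haar_sum F (fun J => sigma J * c J).
pose q := \int[leb]_x (haar I x * (k x * b x)).
(* The cross term of the new summand with the sum k so far is e c_I q. *)
pose e : R := if 0 <= c I * q then 1 else -1.
have e1 : e = 1 \/ e = -1 by rewrite /e; case: ifP; [left|right].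
have ecq : 0 <= e * (c I * q).
  rewrite /e; case: ifPn; first by rewrite mul1r.
  by rewrite -ltNge mulN1r oppr_ge0 => /ltW.
exists (fun J => if J == I then e else sigma J).
  by move=> J; case: ifP => // _; exact: sg.
have -> : haar_sum (I :: F) (fun J => (if J == I then e else sigma J) * c J) =
    (fun x => e * c I * haar I x + k x).
  apply/funext => x; rewrite /haar_sum big_cons eqxx; congr (_ + _).
  apply: eq_big_seq => J JF; case: eqP => // JI.
  by move: IF; rewrite -JI JF.
have tk : test_function k := test_haar_sum _ _.
have th := test_haar R I.
have i1 := test_integrable (testM th th) lb.
have i2 := test_integrable tk (test_locint tk lb).
have i3 := test_integrable th (test_locint tk lb).
have -> : \int[leb]_x ((e * c I * haar I x + k x) ^+ 2 * b x) =
  (e * c I) ^+ 2 * (mass b I / dlen I) + 2 * (e * (c I * q)) +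
  \int[leb]_x (k x ^+ 2 * b x).
  rewrite -haar_sqr_mass// /q !(mulrA 2) (mulrA (2 * e)).
  have -> : \int[leb]_x (haar I x ^+ 2 * b x) =
      \int[leb]_x (haar I x * haar I x * b x).
    by apply: eq_Rintegral => x _; rewrite expr2.
  have -> : \int[leb]_x (k x ^+ 2 * b x) = \int[leb]_x (k x * (k x * b x)).
    by apply: eq_Rintegral => x _; rewrite expr2 mulrA.
  have j1 := integrableZl measurableT ((e * c I) ^+ 2) i1.
  have j3 := integrableZl measurableT (2 * e * c I) i3.
  rewrite -!RintegralZl// -!RintegralD//.
    by apply: eq_Rintegral => x _; ring.
  by have := integrableD measurableT j1 j3; apply: eq_integrable.
rewrite big_cons; apply: lerD => //.
have -> : (e * c I) ^+ 2 = c I ^+ 2 by case: e1 => ->; rewrite ?mul1r ?mulN1r ?sqrrN.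
by rewrite lerDl mulr_ge0.
Qed.

(** Each Haar function satisfies h_I^2 = 1_I / |I|, so the left-hand
    side is the square of the norm in L^2(b) of the square function of the
    multiplier; the choice of signs reduces it to [multiplier_bound]. *)
Lemma square_function_bound (R : realType) (a b : R -> R) (mu : dyadic -> R)
    (C : R) (F : seq dyadic) (f : R -> R) :
  (forall x, 0 < a x) -> (forall x, 0 < b x) -> locint b -> (forall I, 0 <= mu I) ->
  0 <= C -> bilinear_bound a b mu C -> uniq F -> L2 (winv a) f ->
  \sum_(I <- F) mu I ^+ 2 * jump (mass f) I ^+ 2 / dlen I ^+ 2 * mass b I <=
  C ^+ 2 * sqnorm (winv a) f.
Proof.
move=> a0 b0 lb mu0 C0 H uF Lf.
have [sigma sg le] :=
  exists_signs (fun I => mu I * (jump (mass f) I / Num.sqrt (dlen I))) b0 lb uF.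
apply: le_trans (multiplier_bound a0 b0 lb mu0 C0 H uF Lf sg).
apply: le_trans le; rewrite le_eqVlt; apply/orP; left; apply/eqP.
apply: eq_bigr => I _; rewrite !exprMn exprVn sqr_sqrtr ?(ltW (dlen_gt0 _ _))//.
have L0 : dlen I != 0 :> R by rewrite gt_eqF ?dlen_gt0.
by field.
Qed.

(** * The bilinear bound and the four conditions *)

Lemma sum_cauchy_schwarz (R : rcfType) (T : Type) (s : seq T) (x y : T -> R) :
  \sum_(i <- s) x i * y i <=
  Num.sqrt (\sum_(i <- s) x i ^+ 2) * Num.sqrt (\sum_(i <- s) y i ^+ 2).
Proof.
elim: s => [|i s IH]; first by rewrite !big_nil sqrtr0 mul0r.
rewrite !big_cons; apply: (le_trans (lerD (lexx _) IH)).
have : 0 <= \sum_(j <- s) x j ^+ 2 by apply: sumr_ge0 => j _; rewrite sqr_ge0.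
have : 0 <= \sum_(j <- s) y j ^+ 2 by apply: sumr_ge0 => j _; rewrite sqr_ge0.
move: (\sum_(j <- s) y j ^+ 2) (\sum_(j <- s) x j ^+ 2) => B A B0 A0.
rewrite -[leRHS]sqrtrM ?addr_ge0 ?sqr_ge0//.
apply: (le_trans (ler_norm _)); rewrite -sqrtr_sqr ler_wsqrtr//.
have := sqr_sqrtr A0; have := sqr_sqrtr B0.
move: (Num.sqrt A) (Num.sqrt B) => p q <- <-.
rewrite -subr_ge0.
have -> : (x i ^+ 2 + p ^+ 2) * (y i ^+ 2 + q ^+ 2) - (x i * y i + p * q) ^+ 2 =
  (x i * q - y i * p) ^+ 2 by ring.
exact: sqr_ge0.
Qed.

Definition joint_bound (R : realType) (a b : R -> R) (mu : dyadic -> R)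
    (C : R) : Prop :=
  forall I, mu I ^+ 2 * mass a I * mass b I / dlen I ^+ 2 <= C.

(** A quarter of the summand of index I in the Carleson condition, because the
    difference of averages over the halves is twice the jump divided by |I|. *)
Definition carleson_weight (R : realType) (a b : R -> R) (mu : dyadic -> R)
    (I : dyadic) : R :=
  mu I ^+ 2 * jump (mass a) I ^+ 2 / dlen I ^+ 2 * mass b I.

Definition carleson_bounded (R : realType) (a b : R -> R) (mu : dyadic -> R)
    (C : R) : Prop :=
  forall (F : seq dyadic) (I : dyadic), uniq F ->
    (forall J, J \in F -> dset J `<=` (dset I : set R)) ->
    \sum_(J <- F) carleson_weight a b mu J <= C * mass a I.

(** A quarter of lambda_I / |I|^2, where lambda_I is the coefficient of the
    positive operator. *)
Definition pos_coef (R : realType) (a b : R -> R) (mu : dyadic -> R)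
    (I : dyadic) : R :=
  mu I * (`|jump (mass a) I| / mass a I) * (`|jump (mass b) I| / mass b I)
  / dlen I.

Definition positive_bound (R : realType) (a b : R -> R) (mu : dyadic -> R)
    (C : R) : Prop :=
  forall (F : seq dyadic) (f h : R -> R),
    uniq F -> L2 (winv a) f -> L2 (winv b) h ->
    \sum_(I <- F) pos_coef a b mu I * `|mass f I| * `|mass h I| <=
    C * Num.sqrt (sqnorm (winv a) f) * Num.sqrt (sqnorm (winv b) h).

Lemma mass_indic (R : realType) (f : R -> R) (I J : dyadic) :
  dset J `<=` (dset I : set R) ->
  mass (fun x => \1_(dset I) x * f x) J = mass f J.
Proof.
move=> JI; apply: eq_Rintegral => x xJ.
by rewrite indicE mem_set ?mul1r//; apply: JI; exact: set_mem.
Qed.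

(** The square function bound for f = a 1_I, whose square has integral
    A(I) against 1/a and whose jumps inside I are those of a. *)
Lemma bilinear_carleson (R : realType) (a b : R -> R) (mu : dyadic -> R)
    (C : R) :
  (forall x, 0 < a x) -> (forall x, 0 < b x) -> locint a -> locint b ->
  (forall I, 0 <= mu I) -> 0 <= C -> bilinear_bound a b mu C ->
  carleson_bounded a b mu (C ^+ 2).
Proof.
move=> a0 b0 la lb mu0 C0 H F I uF FI.
have [Lf Nf] := test_mul_L2 a0 la (test_indic R I).
have := square_function_bound a0 b0 lb mu0 C0 H uF Lf; rewrite Nf.
have -> : \int[leb]_x (\1_(dset I) x ^+ 2 * a x) = mass a I.
  rewrite -Rintegral_indic; apply: eq_Rintegral => x _.
  by rewrite indicE; case: (_ \in _); rewrite ?expr1n ?expr0n.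
apply: le_trans; rewrite le_eqVlt; apply/orP; left; apply/eqP.
apply: eq_big_seq => J /FI JI; rewrite /carleson_weight /jump !mass_indic//.
- by apply: subset_trans JI; rewrite [X in _ `<=` X](dset_split R J); exact: subsetUl.
- by apply: subset_trans JI; rewrite [X in _ `<=` X](dset_split R J); exact: subsetUr.
Qed.

Lemma sum_energies_le (R : realType) (a b f h : R -> R) (F : seq dyadic) :
  (forall x, 0 < a x) -> (forall x, 0 < b x) -> locint a -> locint b ->
  uniq F -> L2 (winv a) f -> L2 (winv b) h ->
  \sum_(I <- F) Num.sqrt (energy (mass a) (mass f) I) *
                Num.sqrt (energy (mass b) (mass h) I) <=
  Num.sqrt (sqnorm (winv a) f) * Num.sqrt (sqnorm (winv b) h).
Proof.
move=> a0 b0 la lb uF Lf Lh; apply: (le_trans (sum_cauchy_schwarz _ _ _)).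
have [lf _] := mass_sqr_le a0 la Lf; have [lh _] := mass_sqr_le b0 lb Lh.
have ea := energy_ge0 (mass_splits la) (mass_splits lf) (fun I => mass_gt0 I la a0).
have eb := energy_ge0 (mass_splits lb) (mass_splits lh) (fun I => mass_gt0 I lb b0).
under eq_bigr do rewrite (sqr_sqrtr (ea _)).
under [X in _ * Num.sqrt X]eq_bigr do rewrite (sqr_sqrtr (eb _)).
by apply: ler_pM; rewrite ?sqrtr_ge0 ?ler_wsqrtr// bessel.
Qed.

Lemma joint_bound_sqrt (R : realType) (a b : R -> R) (mu : dyadic -> R) (C : R) I :
  (forall x, 0 < a x) -> (forall x, 0 < b x) -> locint a -> locint b ->
  (forall I, 0 <= mu I) -> joint_bound a b mu C ->
  mu I * (Num.sqrt (mass a I) * Num.sqrt (mass b I)) / dlen I <= Num.sqrt C.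
Proof.
move=> a0 b0 la lb mu0 /(_ I) HC.
have A0 := mass_gt0 I la a0; have B0 := mass_gt0 I lb b0.
rewrite -sqrtrM ?(ltW A0)//.
apply: (le_trans (ler_norm _)); rewrite -sqrtr_sqr ler_wsqrtr//.
by rewrite !exprMn sqr_sqrtr ?mulr_ge0 ?(ltW A0) ?(ltW B0)// exprVn mulrA.
Qed.

Lemma carleson_weight_ge0 (R : realType) (a b : R -> R) (mu : dyadic -> R) I :
  (forall x, 0 < b x) -> locint b -> 0 <= carleson_weight a b mu I.
Proof.
move=> b0 lb; apply: mulr_ge0; last exact: ltW (mass_gt0 I lb b0).
by apply: divr_ge0; [apply: mulr_ge0; exact: sqr_ge0|exact: sqr_ge0].
Qed.

(** Cauchy-Schwarz for sums separates the energies of h, summed by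
    Bessel, from a sum in the averages of f that the embedding theorem bounds by
    4 C; this is where the factor 2 comes from. *)
Lemma cross_term_carleson (R : realType) (a b f h : R -> R) (mu : dyadic -> R)
    (C : R) (F : seq dyadic) :
  (forall x, 0 < a x) -> (forall x, 0 < b x) -> locint a -> locint b ->
  (forall I, 0 <= mu I) -> 0 < C -> carleson_bounded a b mu C ->
  uniq F -> L2 (winv a) f -> L2 (winv b) h ->
  \sum_(I <- F) mu I * (`|jump (mass a) I| / mass a I * `|mass f I|) *
     Num.sqrt (energy (mass b) (mass h) I * mass b I) / dlen I <=
  2 * Num.sqrt C * Num.sqrt (sqnorm (winv a) f) * Num.sqrt (sqnorm (winv b) h).
Proof.
move=> a0 b0 la lb mu0 C0 HC uF Lf Lh.
have [lh _] := mass_sqr_le b0 lb Lh.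
have B0 I := mass_gt0 I lb b0; have A0 I := mass_gt0 I la a0.
have eb := energy_ge0 (mass_splits lb) (mass_splits lh) B0.
pose x I := mu I * (`|jump (mass a) I| / mass a I * `|mass f I|) *
            Num.sqrt (mass b I) / dlen I.
pose y I := Num.sqrt (energy (mass b) (mass h) I).
rewrite (_ : \sum_(I <- F) _ = \sum_(I <- F) x I * y I); last first.
  apply: eq_bigr => I _; rewrite sqrtrM// /x /y; ring.
apply: (le_trans (sum_cauchy_schwarz _ _ _)).
apply: ler_pM; rewrite ?sqrtr_ge0//; last first.
  apply: ler_wsqrtr; under eq_bigr do rewrite (sqr_sqrtr (eb _)).
  exact: bessel.
have -> : 2 = Num.sqrt 4 :> R.
  have -> : 4 = 2 ^+ 2 :> R by ring.
  by rewrite sqrtr_sqr ger0_norm.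
rewrite -!sqrtrM ?mulr_ge0// ?(ltW C0)//; apply: ler_wsqrtr.
have c0 I : 0 <= carleson_weight a b mu I by exact: carleson_weight_ge0.
have cC n I : \sum_(J <- descendants n I) carleson_weight a b mu J <= C * mass a I.
  by apply: HC; [exact: (descendants_uniq R)|move=> J; exact: descendants_sub].
apply: le_trans (carleson_embedding a0 la Lf uF c0 C0 cC).
rewrite le_eqVlt; apply/orP; left; apply/eqP; apply: eq_bigr => I _.
rewrite /x /carleson_weight [(mass f I / _) ^+ 2]expr_div_n.
rewrite -[mass f I ^+ 2]real_normK ?num_real//.
rewrite -[jump _ _ ^+ 2]real_normK ?num_real//.
rewrite -[mass b I in RHS]sqr_sqrtr ?(ltW (B0 I))//.
by field; rewrite !gt_eqF ?dlen_gt0.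
Qed.

(** Expanding both jumps by [jump_le] gives four sums, one for each
    condition. *)
Lemma bilinear_bound_of_conditions (R : realType) (a b : R -> R)
    (mu : dyadic -> R) (C1 C2 C3 C4 : R) :
  (forall x, 0 < a x) -> (forall x, 0 < b x) -> locint a -> locint b ->
  (forall I, 0 <= mu I) -> 0 < C2 -> 0 < C3 ->
  joint_bound a b mu C1 -> carleson_bounded a b mu C2 ->
  carleson_bounded b a mu C3 -> positive_bound a b mu C4 ->
  bilinear_bound a b mu
    (Num.sqrt C1 + 2 * Num.sqrt C2 + 2 * Num.sqrt C3 + C4).
Proof.
move=> a0 b0 la lb mu0 C20 C30 H1 H2 H3 H4 F f h uF Lf Lh.
have [lf _] := mass_sqr_le a0 la Lf; have [lh _] := mass_sqr_le b0 lb Lh.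
have B0 I := mass_gt0 I lb b0; have A0 I := mass_gt0 I la a0.
have sa := mass_splits la; have sb := mass_splits lb.
have sf := mass_splits lf; have sh := mass_splits lh.
have ea := energy_ge0 sa sf A0; have eb := energy_ge0 sb sh B0.
have T1 := ler_wpM2l (sqrtr_ge0 C1) (sum_energies_le a0 b0 la lb uF Lf Lh).
have T2 := cross_term_carleson a0 b0 la lb mu0 C20 H2 uF Lf Lh.
have T3 := cross_term_carleson b0 a0 lb la mu0 C30 H3 uF Lh Lf.
have T4 := H4 F f h uF Lf Lh.
set X := Num.sqrt (sqnorm _ f) in T1 T2 T3 T4 *.
set Y := Num.sqrt (sqnorm _ h) in T1 T2 T3 T4 *.
have -> : (Num.sqrt C1 + 2 * Num.sqrt C2 + 2 * Num.sqrt C3 + C4) * X * Y =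
  Num.sqrt C1 * (X * Y) + 2 * Num.sqrt C2 * X * Y + 2 * Num.sqrt C3 * Y * X +
  C4 * X * Y by ring.
apply: le_trans (lerD (lerD (lerD T1 T2) T3) T4).
rewrite mulr_sumr -!big_split /=; apply: ler_sum => I _.
have L0 := dlen_gt0 R I.
have JF := jump_le I sa sf A0; have JH := jump_le I sb sh B0.
have J1 := joint_bound_sqrt I a0 b0 la lb mu0 H1.
set p := Num.sqrt (energy (mass a) _ I * _) in JF *.
set q := `|jump (mass a) I| / _ * _ in JF *.
set p' := Num.sqrt (energy (mass b) _ I * _) in JH *.
set q' := `|jump (mass b) I| / _ * _ in JH *.
have p0 : 0 <= p by exact: sqrtr_ge0.
have p'0 : 0 <= p' by exact: sqrtr_ge0.
have q0 : 0 <= q by rewrite mulr_ge0// divr_ge0// ltW.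
have q'0 : 0 <= q' by rewrite mulr_ge0// divr_ge0// ltW.
have step : mu I * `|jump (mass f) I| * `|jump (mass h) I| / dlen I <=
    mu I * (p + q) * (p' + q') / dlen I.
  rewrite ler_wpM2r ?invr_ge0 ?(ltW L0)//; apply: ler_pM => //.
    by rewrite mulr_ge0.
  by rewrite ler_wpM2l.
apply: (le_trans step).
have P1 : mu I * p * p' / dlen I <= Num.sqrt C1 *
   (Num.sqrt (energy (mass a) (mass f) I) * Num.sqrt (energy (mass b) (mass h) I)).
  rewrite /p /p' !sqrtrM//.
  have := ler_wpM2r (mulr_ge0 (sqrtr_ge0 (energy (mass a) (mass f) I))
                     (sqrtr_ge0 (energy (mass b) (mass h) I))) J1.
  apply: le_trans; rewrite le_eqVlt; apply/orP; left; apply/eqP; ring.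
have -> : mu I * (p + q) * (p' + q') / dlen I = mu I * p * p' / dlen I +
  mu I * q * p' / dlen I + mu I * q' * p / dlen I + mu I * q * q' / dlen I by ring.
rewrite -!addrA; apply: lerD => //; rewrite !addrA lerD2l.
by rewrite le_eqVlt; apply/orP; left; apply/eqP; rewrite /q /q' /pos_coef; ring.
Qed.

(** Here the jumps of f are kept, so the square function bound replaces
    the embedding theorem. *)
Lemma cross_term_square_function (R : realType) (a b f h : R -> R)
    (mu : dyadic -> R) (C : R) (F : seq dyadic) :
  (forall x, 0 < a x) -> (forall x, 0 < b x) -> locint b ->
  (forall I, 0 <= mu I) -> 0 <= C -> bilinear_bound a b mu C ->
  uniq F -> L2 (winv a) f -> L2 (winv b) h ->
  \sum_(I <- F) mu I * `|jump (mass f) I| *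
     Num.sqrt (energy (mass b) (mass h) I * mass b I) / dlen I <=
  C * Num.sqrt (sqnorm (winv a) f) * Num.sqrt (sqnorm (winv b) h).
Proof.
move=> a0 b0 lb mu0 C0 H uF Lf Lh.
have [lh _] := mass_sqr_le b0 lb Lh.
have B0 I := mass_gt0 I lb b0.
have eb := energy_ge0 (mass_splits lb) (mass_splits lh) B0.
pose x I := mu I * `|jump (mass f) I| * Num.sqrt (mass b I) / dlen I.
pose y I := Num.sqrt (energy (mass b) (mass h) I).
rewrite (_ : \sum_(I <- F) _ = \sum_(I <- F) x I * y I); last first.
  apply: eq_bigr => I _; rewrite sqrtrM// /x /y; ring.
apply: (le_trans (sum_cauchy_schwarz _ _ _)).
apply: ler_pM; rewrite ?sqrtr_ge0//; last first.
  apply: ler_wsqrtr; under eq_bigr do rewrite (sqr_sqrtr (eb _)).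
  exact: bessel.
rewrite -[C]ger0_norm// -sqrtr_sqr -sqrtrM ?sqr_ge0//; apply: ler_wsqrtr.
apply: le_trans (square_function_bound a0 b0 lb mu0 C0 H uF Lf).
rewrite le_eqVlt; apply/orP; left; apply/eqP; apply: eq_bigr => I _.
rewrite /x -[jump _ _ ^+ 2]real_normK ?num_real//.
rewrite -[mass b I in RHS]sqr_sqrtr ?(ltW (B0 I))//.
by field; rewrite !gt_eqF ?dlen_gt0.
Qed.

(** The term in the integrals of f and h is bounded by four sums through
    [jump_ge]: the bilinear form itself, two cross sums and the sum of energies,
    each at most C times the norms. *)
Lemma positive_bound_of_bilinear (R : realType) (a b : R -> R)
    (mu : dyadic -> R) (C : R) :
  (forall x, 0 < a x) -> (forall x, 0 < b x) -> locint a -> locint b ->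
  (forall I, 0 <= mu I) -> 0 <= C ->
  joint_bound a b mu (C ^+ 2) -> bilinear_bound a b mu C ->
  positive_bound a b mu (4 * C).
Proof.
move=> a0 b0 la lb mu0 C0 H1 H F f h uF Lf Lh.
have [lf _] := mass_sqr_le a0 la Lf; have [lh _] := mass_sqr_le b0 lb Lh.
have B0 I := mass_gt0 I lb b0; have A0 I := mass_gt0 I la a0.
have sa := mass_splits la; have sb := mass_splits lb.
have sf := mass_splits lf; have sh := mass_splits lh.
have ea := energy_ge0 sa sf A0; have eb := energy_ge0 sb sh B0.
have T1 := ler_wpM2l C0 (sum_energies_le a0 b0 la lb uF Lf Lh).
have T2 := cross_term_square_function a0 b0 lb mu0 C0 H uF Lf Lh.
have T3 := cross_term_square_function b0 a0 la mu0 C0 (bilinear_boundC H) uF Lh Lf.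
have T4 := H F f h uF Lf Lh.
set X := Num.sqrt (sqnorm _ f) in T1 T2 T3 T4 *.
set Y := Num.sqrt (sqnorm _ h) in T1 T2 T3 T4 *.
have -> : 4 * C * X * Y = C * (X * Y) + C * X * Y + C * Y * X + C * X * Y by ring.
apply: le_trans (lerD (lerD (lerD T1 T2) T3) T4).
rewrite mulr_sumr -!big_split /=; apply: ler_sum => I _.
have L0 := dlen_gt0 R I.
have JF := jump_ge I sa sf A0; have JH := jump_ge I sb sh B0.
have J1 := joint_bound_sqrt I a0 b0 la lb mu0 H1.
rewrite sqrtr_sqr ger0_norm// in J1.
set p := Num.sqrt (energy (mass a) _ I * _) in JF *.
set q := `|jump (mass a) I| / _ * _ in JF *.
set p' := Num.sqrt (energy (mass b) _ I * _) in JH *.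
set q' := `|jump (mass b) I| / _ * _ in JH *.
have p0 : 0 <= p by exact: sqrtr_ge0.
have p'0 : 0 <= p' by exact: sqrtr_ge0.
have q0 : 0 <= q by rewrite mulr_ge0// divr_ge0// ltW.
have q'0 : 0 <= q' by rewrite mulr_ge0// divr_ge0// ltW.
have -> : pos_coef a b mu I * `|mass f I| * `|mass h I| =
  mu I * q * q' / dlen I by rewrite /q /q' /pos_coef; ring.
have step : mu I * q * q' / dlen I <=
    mu I * (`|jump (mass f) I| + p) * (`|jump (mass h) I| + p') / dlen I.
  rewrite ler_wpM2r ?invr_ge0 ?(ltW L0)//; apply: ler_pM => //.
    by rewrite mulr_ge0.
  by rewrite ler_wpM2l.
apply: (le_trans step).
have P1 : mu I * p * p' / dlen I <= C *
   (Num.sqrt (energy (mass a) (mass f) I) * Num.sqrt (energy (mass b) (mass h) I)).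
  rewrite /p /p' !sqrtrM//.
  have := ler_wpM2r (mulr_ge0 (sqrtr_ge0 (energy (mass a) (mass f) I))
                     (sqrtr_ge0 (energy (mass b) (mass h) I))) J1.
  apply: le_trans; rewrite le_eqVlt; apply/orP; left; apply/eqP; ring.
move: P1; move: (C * _) => z P1.
have -> : mu I * (`|jump (mass f) I| + p) * (`|jump (mass h) I| + p') / dlen I =
  mu I * p * p' / dlen I + (mu I * `|jump (mass f) I| * p' / dlen I +
  mu I * `|jump (mass h) I| * p / dlen I +
  mu I * `|jump (mass f) I| * `|jump (mass h) I| / dlen I) by ring.
by rewrite -!(addrA z) lerD2r.
Qed.

(** * Haar multipliers as a bilinear form *)

Lemma norm2E (R : realType) (u f : R -> R) : L2 u f ->
  norm2 u f = (Num.sqrt (sqnorm u f))%:E.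
Proof.
move=> [_ intf]; rewrite /norm2.
have -> : (\int[leb]_x (`|f x| ^+ 2 * u x)%:E)%E =
    (\int[leb]_x (f x ^+ 2 * u x)%:E)%E.
  by apply: eq_integral => x _; rewrite real_normK ?num_real.
by rewrite -(fineK (integrable_fin_num measurableT intf)).
Qed.

Lemma in_L2P (R : realType) (u f : R -> R) :
  measurable_fun [set: R] u -> (forall x, 0 < u x) -> in_L2 u f <-> L2 u f.
Proof.
move=> mu u0; split=> [[mf nf]|Lf]; last first.
  by split; [case: Lf|rewrite norm2E// ltry].
split => //; apply/integrableP; split.
  by apply: measurable_EFin; apply: measurable_funM => //; exact: measurable_funX.
move: nf; rewrite /norm2.
have -> : (\int[leb]_x (`|f x| ^+ 2 * u x)%:E)%E =
    (\int[leb]_x `|(EFin \o (fun x => f x ^+ 2 * u x)%R) x|)%E.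
  apply: eq_integral => x _ /=; rewrite real_normK ?num_real//.
  by rewrite ger0_norm// mulr_ge0 ?sqr_ge0// ltW.
by case: (\int[_]_x _)%E => [r|/=|]; rewrite ?ltry.
Qed.

Lemma L2_norm (R : realType) (u f : R -> R) : L2 u f ->
  L2 u (fun x => `|f x|) /\ sqnorm u (fun x => `|f x|) = sqnorm u f.
Proof.
move=> [mf intf]; split; last first.
  by apply: eq_Rintegral => x _; rewrite real_normK ?num_real.
split; first exact: measurableT_comp.
by apply: eq_integrable intf => // x _ /=; rewrite real_normK ?num_real.
Qed.

Lemma winvK (R : realType) (u : R -> R) : winv (winv u) = u.
Proof. by apply/funext => x; rewrite /winv invrK. Qed.

Definition multiplier_coef (R : realType) (w : R -> R) (t : R) (I : dyadic) : R :=
  (avg w I `^ t)^-1.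

Lemma multiplier_coef_ge0 (R : realType) (w : R -> R) (t : R) (I : dyadic) :
  0 <= multiplier_coef w t I.
Proof. by rewrite invr_ge0 powR_ge0. Qed.

Lemma powR2M (R : realType) (x t : R) : x `^ (2 * t) = (x `^ t) ^+ 2.
Proof. by rewrite mulrC powRrM powR_mulrn// powR_ge0. Qed.

Lemma multiplier_coef_sqr (R : realType) (w : R -> R) (t : R) (I : dyadic) :
  multiplier_coef w t I ^+ 2 = (avg w I `^ (2 * t))^-1.
Proof. by rewrite /multiplier_coef exprVn powR2M. Qed.

Lemma avg_gt0 (R : realType) (w : R -> R) (I : dyadic) :
  locint w -> (forall x, 0 < w x) -> 0 < avg w I.
Proof. by move=> lw w0; rewrite avgE divr_gt0 ?mass_gt0 ?dlen_gt0. Qed.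

Lemma haar_multE (R : realType) (w : R -> R) (t : R) (sigma : dyadic -> R)
    (F : {fset dyadic}) (f : R -> R) (x : R) :
  locint w -> (forall x, 0 < w x) -> locint f ->
  haar_mult w t sigma F f x = w x `^ t *
    haar_sum F (fun I => sigma I * (multiplier_coef w t I *
                 (jump (mass f) I / Num.sqrt (dlen I)))) x.
Proof.
move=> lw w0 lf; rewrite /haar_mult /haar_sum mulr_sumr; apply: eq_bigr => I _.
have aw := avg_gt0 I lw w0.
have -> : (w x / avg w I) `^ t = w x `^ t * multiplier_coef w t I.
  have wE : w x = w x / avg w I * avg w I by rewrite divfK ?gt_eqF.
  rewrite [in RHS]wE [in RHS]powRM ?divr_ge0 ?(ltW aw) ?(ltW (w0 x))//.
  by rewrite /multiplier_coef mulfK// gt_eqF// powR_gt0.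
by rewrite inner_haar//; ring.
Qed.

Lemma haar_mult_sqr (R : realType) (v w : R -> R) (t : R) (sigma : dyadic -> R)
    (F : {fset dyadic}) (f : R -> R) (x : R) :
  locint w -> (forall x, 0 < w x) -> locint f ->
  `|haar_mult w t sigma F f x| ^+ 2 * v x =
    haar_sum F (fun I => sigma I * (multiplier_coef w t I *
                 (jump (mass f) I / Num.sqrt (dlen I)))) x ^+ 2 * vw2t v w t x.
Proof.
move=> lw w0 lf; rewrite real_normK ?num_real// haar_multE//.
by rewrite /vw2t powR2M; ring.
Qed.

Lemma norm2_haar_mult (R : realType) (v w : R -> R) (t : R) (sigma : dyadic -> R)
    (F : {fset dyadic}) (f : R -> R) :
  locint w -> (forall x, 0 < w x) -> locint (vw2t v w t) -> locint f ->
  norm2 v (haar_mult w t sigma F f) =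
  (Num.sqrt (\int[leb]_x (haar_sum F (fun I => sigma I * (multiplier_coef w t I *
     (jump (mass f) I / Num.sqrt (dlen I)))) x ^+ 2 * vw2t v w t x)))%:E.
Proof.
move=> lw w0 lb lf; rewrite /norm2.
under eq_integral do rewrite haar_mult_sqr//.
set k := haar_sum _ _.
have tk : test_function k := test_haar_sum _ _.
have intk : leb.-integrable [set: R] (EFin \o (fun x => k x ^+ 2 * vw2t v w t x)).
  have := test_integrable (testM tk tk) lb.
  by apply: eq_integrable => // x _ /=; rewrite expr2.
by rewrite -(fineK (integrable_fin_num measurableT intk)).
Qed.

(** Choose the sign at I to be that of the product of the Haar coefficients
    of f and h; then the bilinear sum is the pairing of h with the multiplier. *)
Lemma bilinear_of_haar_mult (R : realType) (u v w : R -> R) (t C : R) :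
  (forall x, 0 < u x) -> (forall x, 0 < v x) -> (forall x, 0 < w x) ->
  measurable_fun [set: R] u -> locint w -> locint (winv u) ->
  locint (vw2t v w t) -> haar_mult_bound u v w t C ->
  bilinear_bound (winv u) (vw2t v w t) (multiplier_coef w t) C.
Proof.
move=> u0 v0 w0 mu lw la lb [C0 H] F f h uF Lf Lh.
have b0 x : 0 < vw2t v w t x by rewrite mulr_gt0// powR_gt0.
have a0 := winv_gt0 u0.
have [lf _] := mass_sqr_le a0 la Lf; have [lh _] := mass_sqr_le b0 lb Lh.
rewrite winvK in Lf *.
pose sigma I : R := if 0 <= jump (mass f) I * jump (mass h) I then 1 else -1.
have sg : signs sigma by move=> I; rewrite /sigma; case: ifP; [left|right].
have sgE I : sigma I * (jump (mass f) I * jump (mass h) I) =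
    `|jump (mass f) I| * `|jump (mass h) I|.
  rewrite -normrM /sigma; case: ifPn => [?|]; first by rewrite mul1r ger0_norm.
  by rewrite -ltNge => ?; rewrite mulN1r ltr0_norm.
pose FF : {fset dyadic} := [fset I in F]%fset.
have FFF : perm_eq (enum_fset FF) F.
  by apply: uniq_perm => //; move=> I; rewrite inE.
have [L2f NE] := (in_L2P f mu u0, norm2E Lf).
have := H sigma FF f sg lf (L2f.2 Lf).
rewrite NE norm2_haar_mult// -EFinM lee_fin.
set c := (X in haar_sum _ X).
have -> : haar_sum FF c = haar_sum F c.
  by apply/funext => x; rewrite /haar_sum (perm_big _ FFF).
move=> le.
have tk : test_function (haar_sum F c) := test_haar_sum _ _.
have ik : leb.-integrable [set: R]
    (EFin \o (fun x => haar_sum F c x ^+ 2 * vw2t v w t x)).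
  have := test_integrable (testM tk tk) lb.
  by apply: eq_integrable => // x _ /=; rewrite expr2.
have mk : measurable_fun [set: R] (haar_sum F c) by case: tk.
have [_ cs] := cauchy_schwarz measurableT b0 mk Lh.1 ik Lh.2.
have -> : \sum_(I <- F)
      multiplier_coef w t I * `|jump (mass f) I| * `|jump (mass h) I| / dlen I
    = \int[leb]_x (haar_sum F c x * h x).
  rewrite integral_haar_sum//; apply: eq_bigr => I _.
  have L0 := dlen_gt0 R I.
  have s0 : Num.sqrt (dlen I) != 0 :> R by rewrite gt_eqF// sqrtr_gt0.
  rewrite -(mulrA (multiplier_coef w t I)) -sgE /c -[in LHS](sqr_sqrtr (ltW L0)).
  by move: s0; move: (Num.sqrt _) => s s0; field.
have I0 : 0 <= \int[leb]_x (haar_sum F c x ^+ 2 * vw2t v w t x).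
  by apply: Rintegral_ge0 => x _; rewrite mulr_ge0 ?sqr_ge0// ltW.
apply: (le_trans (ler_norm _)); rewrite -sqrtr_sqr.
apply: (@le_trans _ _ (Num.sqrt (\int[leb]_x (haar_sum F c x ^+ 2 * vw2t v w t x))
  * Num.sqrt (sqnorm (winv (vw2t v w t)) h))).
  by rewrite -sqrtrM//; apply: ler_wsqrtr.
by rewrite ler_wpM2r// sqrtr_ge0.
Qed.

Lemma haar_mult_of_bilinear (R : realType) (u v w : R -> R) (t C : R) :
  (forall x, 0 < u x) -> (forall x, 0 < v x) -> (forall x, 0 < w x) ->
  measurable_fun [set: R] u -> locint w ->
  locint (vw2t v w t) -> 0 <= C ->
  bilinear_bound (winv u) (vw2t v w t) (multiplier_coef w t) C ->
  haar_mult_bound u v w t C.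
Proof.
move=> u0 v0 w0 mu lw lb C0 H; split => // sigma F f sg lf /(in_L2P f mu u0) Lf.
have b0 x : 0 < vw2t v w t x by rewrite mulr_gt0// powR_gt0.
rewrite (norm2E Lf) norm2_haar_mult// -EFinM lee_fin -[C]ger0_norm// -sqrtr_sqr.
rewrite -sqrtrM ?sqr_ge0//; apply: ler_wsqrtr.
have Lf' : L2 (winv (winv u)) f by rewrite winvK.
have := multiplier_bound (winv_gt0 u0) b0 lb (multiplier_coef_ge0 w t) C0 H
  (fset_uniq F) Lf' sg.
by rewrite winvK.
Qed.

(** * Necessity of the joint condition *)

Lemma avge_gt0 (R : realType) (f : R -> R) (I : dyadic) :
  measurable_fun [set: R] f -> (forall x, 0 < f x) -> (0 < avge f I)%E.
Proof.
move=> mf f0; rewrite /avge mule_gt0 ?integral_dset_gt0//.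
by rewrite lte_fin invr_gt0 dlen_gt0.
Qed.

Lemma avge_mass (R : realType) (f : R -> R) (I : dyadic) : locint f ->
  avge f I = (mass f I / dlen I)%:E.
Proof.
move=> lf; rewrite -avgE /avg fineK// /avge fin_numM//.
exact: (integrable_fin_num (@measurable_dset R I) (locint_dset I lf)).
Qed.

Lemma avge_lty_locint (R : realType) (f : R -> R) :
  measurable_fun [set: R] f -> (forall x, 0 < f x) ->
  (forall I, (avge f I < +oo)%E) -> locint f.
Proof.
move=> mf f0 fy; apply: integrable_dsets_locint => // I.
apply/integrableP; split; first exact: measurable_EFin.
have := fy I; rewrite /avge.
have -> : (\int[leb]_(x in dset I) `|(EFin \o f) x|)%E =
    (\int[leb]_(x in dset I) (f x)%:E)%E.
  by apply: eq_integral => x _ /=; rewrite ger0_norm// ltW.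
rewrite !ltey; apply: contra => /eqP ->.
by rewrite gt0_muley// lte_fin invr_gt0 dlen_gt0.
Qed.

(** Since 1/u is not known to be locally integrable when the joint condition
    is derived, the test functions must be built from truncations. *)
Lemma truncation_cvg (R : realType) (a : R -> R) (I : dyadic) :
  measurable_fun [set: R] a -> (forall x, 0 < a x) ->
  ((\int[leb]_(x in dset I) (Num.min (a x) n.+1%:R)%:E)%E @[n --> \oo] -->
   (\int[leb]_(x in dset I) (a x)%:E)%E).
Proof.
move=> ma a0.
have mI := @measurable_dset R I.
pose g (n : nat) (x : R) : \bar R := (Num.min (a x) n.+1%:R)%:E.
have mg n : measurable_fun (dset I : set (measurableTypeR R)) (g n).
  by apply: measurable_EFin; exact: measurable_minr.
have g0 n x : dset I x -> (0 <= g n x)%E.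
  by move=> _; rewrite lee_fin le_min ltW//=.
have ndg x : dset I x -> {homo g^~ x : n m / (n <= m)%N >-> (n <= m)%E}.
  move=> _ n m nm; rewrite lee_fin le_min ge_min lexx /= ge_min.
  by rewrite ler_nat ltnS nm orbT.
have := @cvg_monotone_convergence _ _ _ leb _ mI g mg g0 ndg.
have -> // : (\int[leb]_(x in dset I) (fun x => limn (g^~ x)) x)%E =
    (\int[leb]_(x in dset I) (a x)%:E)%E.
apply: eq_integral => x _; apply/cvg_lim => //.
apply: cvg_near_cst; near=> n.
rewrite /g; congr EFin; apply/min_idPl.
have : a x < (Num.bound (a x))%:R by rewrite archi_boundP// ltW.
move=> /ltW /le_trans; apply; rewrite ler_nat.
near: n; exists (Num.bound (a x)) => // n /= h.
exact: leqW.
Unshelve. all: by end_near.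
Qed.

(** No sign of u is assumed, so that the lemma applies before u is changed
    on a null set. *)
Lemma measurable_winv (R : realType) (u : R -> R) :
  measurable_fun [set: R] u -> measurable_fun [set: R] (winv u).
Proof.
(* The formula is also correct at 0, where both sides are 0. *)
move=> mu; have -> : winv u = (fun x => u x * (u x ^+ 2) `^ (-1)).
  apply/funext => x; rewrite powR_inv1 ?sqr_ge0// /winv.
  have [->|ux] := eqVneq (u x) 0; first by rewrite invr0 mul0r.
  by field.
apply: measurable_funM => //.
by apply: (measurableT_comp (measurable_powR _)); exact: measurable_funX.
Qed.

Lemma measurable_vw2t (R : realType) (v w : R -> R) (t : R) :
  measurable_fun [set: R] v -> measurable_fun [set: R] w ->
  measurable_fun [set: R] (vw2t v w t).
Proof.
move=> mv mw; apply: measurable_funM => //.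
by apply: (measurableT_comp (measurable_powR _)).
Qed.

Lemma locint_truncation (R : realType) (a : R -> R) (m : R) :
  measurable_fun [set: R] a -> (forall x, 0 < a x) -> 0 < m ->
  locint (fun x => Num.min (a x) m).
Proof.
move=> ma a0 m0; apply: integrable_dsets_locint; first exact: measurable_minr.
move=> I; have mI := @measurable_dset R I.
have := integrableZl mI m (locint_dset I (locint1 R)).
apply: le_integrable => //.
  by apply: measurable_EFin; exact: measurable_minr.
move=> x _ /=; rewrite mulr1 lee_fin !ger0_norm ?(ltW m0)//.
  by rewrite ge_min lexx orbT.
by rewrite le_min !ltW.
Qed.

Lemma multiplier_coef_gt0 (R : realType) (w : R -> R) (t : R) (I : dyadic) :
  locint w -> (forall x, 0 < w x) -> 0 < multiplier_coef w t I.
Proof. by move=> lw w0; rewrite invr_gt0 powR_gt0// avg_gt0. Qed.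

(** The average on the right may be infinite: no integrability of
    v w^(2t) is available at this stage. *)
Lemma norm2_haar_mult1 (R : realType) (v w f : R -> R) (t : R) (I : dyadic) :
  (forall x, 0 < v x) -> (forall x, 0 < w x) ->
  measurable_fun [set: R] v -> locint w -> locint f ->
  norm2 v (haar_mult w t (fun=> 1) [fset I]%fset f) =
  sqrte (((multiplier_coef w t I * (jump (mass f) I / Num.sqrt (dlen I))) ^+ 2)%:E *
         avge (vw2t v w t) I)%E.
Proof.
move=> v0 w0 mv lw lf; rewrite /norm2; congr sqrte.
have b0 x : 0 < vw2t v w t x by rewrite mulr_gt0// powR_gt0.
have mb := measurable_vw2t t mv (locint_measurable lw).
under eq_integral do rewrite haar_mult_sqr//.
set c := multiplier_coef w t I * _; rewrite /avge muleA -EFinM.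
rewrite [X in _ = (_ * X)%E]integral_mkcond.
rewrite -ge0_integralZl_EFin//; last 3 first.
- move=> x _; rewrite patchE; case: ifP => // _; rewrite lee_fin ltW//.
- by apply/(measurable_restrictT _ (@measurable_dset R I)); exact: measurable_EFin.
- by rewrite mulr_ge0 ?sqr_ge0// invr_ge0 ltW// dlen_gt0.
apply: eq_integral => x _.
rewrite /haar_sum big_seq_fset1 mul1r -/c exprMn patchE.
rewrite [haar I x ^+ 2]haar_sqr indicE; case: (x \in dset I).
  by rewrite mulr1 -EFinM.
by rewrite !mulr0 mul0r mule0.
Qed.

(** Test on f = h_I min(1/u, m) with the family reduced to I: then
    f^2 u <= h_I^2 min(1/u, m), so that the square of its norm is at most its own
    Haar coefficient. *)
Lemma haar_test_bound (R : realType) (u v w : R -> R) (t C m : R) (I : dyadic) :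
  (forall x, 0 < u x) -> (forall x, 0 < v x) -> (forall x, 0 < w x) ->
  measurable_fun [set: R] u -> measurable_fun [set: R] v -> locint w ->
  haar_mult_bound u v w t C -> 0 < m ->
  ((multiplier_coef w t I ^+ 2)%:E * avge (fun x => Num.min (winv u x) m) I *
    avge (vw2t v w t) I <= (C ^+ 2)%:E)%E.
Proof.
move=> u0 v0 w0 mu mv lw [C0 H] m0.
have mw := locint_measurable lw.
have a0 := winv_gt0 u0.
have ma := measurable_winv mu.
pose am x := Num.min (winv u x) m.
have am0 x : 0 < am x by rewrite lt_min a0.
have lam : locint am by exact: locint_truncation.
have mam := locint_measurable lam.
pose M := mass am I / dlen I.
have M0 : 0 < M by rewrite divr_gt0 ?mass_gt0 ?dlen_gt0.
pose f x := haar I x * am x.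
have lf : locint f by apply: test_locint lam; exact: test_haar.
have th := test_haar R I.
(* Uses am u <= (1/u) u = 1. *)
have fu x : f x ^+ 2 * u x <= haar I x ^+ 2 * am x.
  rewrite /f exprMn -mulrA ler_wpM2l ?sqr_ge0// expr2 -mulrA.
  rewrite -[leRHS]mulr1 ler_wpM2l ?(ltW (am0 x))//.
  rewrite -ler_pdivlMr// div1r /am /winv ge_min lexx//.
have ih : leb.-integrable [set: R] (EFin \o (fun x => haar I x ^+ 2 * am x)).
  have := test_integrable (testM th th) lam.
  by apply: eq_integrable => // x _ /=; rewrite expr2.
have Lf : L2 u f.
  split; first exact: locint_measurable.
  apply: (le_integrable _ _ _ ih) => //.
    apply: measurable_EFin; apply: measurable_funM => //.
    by apply: measurable_funX; exact: locint_measurable.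
  move=> x _ /=; have p1 := mulr_ge0 (sqr_ge0 (f x)) (ltW (u0 x)).
  have p2 := mulr_ge0 (sqr_ge0 (haar I x)) (ltW (am0 x)).
  by rewrite lee_fin !ger0_norm.
have NM : sqnorm u f <= M.
  by rewrite /M -haar_sqr_mass//; apply: le_Rintegral => //; exact: Lf.2.
have JM : jump (mass f) I / Num.sqrt (dlen I) = M.
  rewrite -inner_haar// -integral_haar /M -haar_sqr_mass//.
  by apply: eq_Rintegral => x _; rewrite mulrA expr2.
have := H (fun=> 1) [fset I]%fset f (fun=> or_introl erefl) lf ((in_L2P f mu u0).2 Lf).
rewrite (norm2E Lf) norm2_haar_mult1// JM -EFinM (avge_mass I lam) -/M.
have c0 := multiplier_coef_gt0 t I lw w0.
have := avge_gt0 I (measurable_vw2t t mv mw)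
  (fun x => mulr_gt0 (v0 x) (powR_gt0 (2 * t) (w0 x))).
case: (avge (vw2t v w t) I) => [r|_|]; last by rewrite ltNge leNye.
  2: (rewrite gt0_muley; [|by rewrite lte_fin exprn_gt0// mulr_gt0]).
  2: by rewrite [X in (X <= _)%E]/= leye_eq.
rewrite lte_fin -!EFinM !lee_fin => r0 h.
have : (multiplier_coef w t I * M) ^+ 2 * r <= C ^+ 2 * M.
  apply: (@le_trans _ _ (C ^+ 2 * sqnorm u f)); last by rewrite ler_wpM2l ?sqr_ge0.
  rewrite -(@ler_sqrt _ _ (C ^+ 2 * _)) ?mulr_ge0 ?sqr_ge0 ?sqnorm_ge0//.
  by rewrite [leRHS]sqrtrM ?sqr_ge0// sqrtr_sqr ger0_norm.
have -> : (multiplier_coef w t I * M) ^+ 2 * r =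
  multiplier_coef w t I ^+ 2 * M * r * M by ring.
by rewrite ler_pM2r.
Qed.

Lemma joint_of_haar_mult (R : realType) (u v w : R -> R) (t C : R) :
  (forall x, 0 < u x) -> (forall x, 0 < v x) -> (forall x, 0 < w x) ->
  measurable_fun [set: R] u -> measurable_fun [set: R] v -> locint w ->
  haar_mult_bound u v w t C -> (joint_const u v w t <= (C ^+ 2)%:E)%E.
Proof.
move=> u0 v0 w0 mu mv lw H; apply: ge_ereal_sup => _ [I _ <-].
rewrite -multiplier_coef_sqr.
have mw := locint_measurable lw.
have h (n : nat) :=
  @haar_test_bound R u v w t C n.+1%:R I u0 v0 w0 mu mv lw H (ltr0Sn _ _).
have c0 : 0 < multiplier_coef w t I ^+ 2 by rewrite exprn_gt0 ?multiplier_coef_gt0.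
have b0 := avge_gt0 I (measurable_vw2t t mv mw)
  (fun x => mulr_gt0 (v0 x) (powR_gt0 (2 * t) (w0 x))).
have a10 : (0 < avge (fun x => Num.min (winv u x) 1%:R) I)%E.
  apply: avge_gt0; first by apply: measurable_minr => //; exact: measurable_winv.
  by move=> x; rewrite lt_min winv_gt0//=.
case: (avge (vw2t v w t) I) b0 h => [r|_|]; last by rewrite ltNge leNye.
  2: by move=> /(_ 0%N); rewrite gt0_muley ?leye_eq// mule_gt0// lte_fin.
rewrite lte_fin => r0 h.
have L0 := dlen_gt0 R I.
have k0 : 0 < multiplier_coef w t I ^+ 2 * (dlen I)^-1 * r.
  by apply: mulr_gt0 => //; apply: mulr_gt0 => //; rewrite invr_gt0.
have : ((\int[leb]_(x in dset I) (winv u x)%:E) <=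
   (C ^+ 2 / (multiplier_coef w t I ^+ 2 * (dlen I)^-1 * r))%:E)%E.
  have cvgI := @truncation_cvg R (winv u) I (measurable_winv mu) (winv_gt0 u0).
  (* The bound is uniform in the truncation level. *)
  rewrite -(cvg_lim _ cvgI)//; apply: lime_le; first exact: cvgP cvgI.
  near=> n; have := h n; rewrite /avge.
  set z := (\int[leb]_(x in _) _)%E => hz.
  rewrite EFinM lee_pdivlMr// muleC.
  move: hz; rewrite !EFinM; congr (_ <= _)%E.
  by rewrite !muleA (muleAC _ z).
rewrite EFinM lee_pdivlMr//; apply: le_trans.
rewrite /avge le_eqVlt; apply/orP; left; apply/eqP.
set z := (\int[leb]_(x in _) _)%E.
rewrite (muleC _ z) -!muleA -!EFinM; congr (z * EFin _)%E; ring.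
Unshelve. all: by end_near.
Qed.

(** * The joint and Carleson conditions in terms of integrals *)

(** Both averages are positive, so neither can be infinite when the product
    is finite. *)
Lemma locint_of_joint (R : realType) (u v w : R -> R) (t : R) :
  (forall x, 0 < u x) -> (forall x, 0 < v x) -> (forall x, 0 < w x) ->
  measurable_fun [set: R] u -> measurable_fun [set: R] v -> locint w ->
  (joint_const u v w t < +oo)%E -> locint (winv u) /\ locint (vw2t v w t).
Proof.
move=> u0 v0 w0 mu mv lw Cy.
have ma := measurable_winv mu.
have mb := measurable_vw2t t mv (locint_measurable lw).
have b0 x : 0 < vw2t v w t x by rewrite mulr_gt0// powR_gt0.
have a0 := winv_gt0 u0.
have k0 I : (0 < ((avg w I `^ (2 * t))^-1)%:E)%E.
  by rewrite lte_fin invr_gt0 powR_gt0// avg_gt0.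
have h I : (avge (winv u) I * avge (vw2t v w t) I *
    ((avg w I `^ (2 * t))^-1)%:E < +oo)%E.
  by apply: le_lt_trans Cy; apply: ereal_sup_ubound; exists I.
split; apply: avge_lty_locint => // I; have := h I; apply: contraTT;
  rewrite -!leNgt !leye_eq => /eqP ->.
  by rewrite gt0_mulye ?avge_gt0// gt0_mulye.
by rewrite gt0_muley ?avge_gt0// gt0_mulye.
Qed.

Lemma joint_boundP (R : realType) (u v w : R -> R) (t C : R) :
  locint (winv u) -> locint (vw2t v w t) ->
  (joint_const u v w t <= C%:E)%E <->
  joint_bound (winv u) (vw2t v w t) (multiplier_coef w t) C.
Proof.
move=> la lb; have e I : (avge (winv u) I * avge (vw2t v w t) I *
    ((avg w I `^ (2 * t))^-1)%:E)%E =
  (multiplier_coef w t I ^+ 2 * mass (winv u) I * mass (vw2t v w t) I / dlen I ^+ 2)%:E.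
  rewrite !avge_mass// -!EFinM -multiplier_coef_sqr; congr EFin.
  by field; rewrite gt_eqF ?dlen_gt0.
split => [h I|h].
  rewrite -lee_fin -e; apply: le_trans h; apply: ereal_sup_ubound; by exists I.
by apply: ge_ereal_sup => _ [I _ <-]; rewrite e lee_fin.
Qed.

Lemma carleson_boundP (R : realType) (a b w : R -> R) (t C : R) :
  locint a -> (forall x, 0 < b x) -> locint b ->
  carleson_bound a b w t C <->
  0 < C /\ carleson_bounded a b (multiplier_coef w t) (C / 4).
Proof.
move=> la b0 lb.
have e J : dlen J * `|Delta a J| ^+ 2 * (avg b J / avg w J `^ (2 * t)) =
    4 * carleson_weight a b (multiplier_coef w t) J.
  rewrite /carleson_weight multiplier_coef_sqr avgE DeltaE real_normK ?num_real//.
  have L0 : dlen J != 0 :> R by rewrite gt_eqF ?dlen_gt0.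
  by move: (avg w J `^ (2 * t))^-1 => z; field.
have cw0 J := @carleson_weight_ge0 R a b (multiplier_coef w t) J b0 lb.
split=> -[C0 H]; split => //.
  move=> F I uF FI; have := H I; rewrite avgE.
  rewrite lee_pdivrMl ?dlen_gt0// -EFinM => h.
  suff : 4 * \sum_(J <- F) carleson_weight a b (multiplier_coef w t) J <=
    C * mass a I by lra.
  have -> : C * mass a I = dlen I * (C * (mass a I / dlen I)).
    by field; rewrite gt_eqF ?dlen_gt0.
  rewrite -lee_fin; apply: le_trans h; apply: esum_ge.
  exists [set` F]; first by split; [exact: finite_seq|move=> J /= /FI].
  rewrite -fsbig_seq// sumEFin lee_fin mulr_sumr.
  by under [in leRHS]eq_bigr do rewrite e.
move=> I; rewrite avgE lee_pdivrMl ?dlen_gt0// -EFinM.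
have -> : dlen I * (C * (mass a I / dlen I)) = C * mass a I.
  by field; rewrite gt_eqF ?dlen_gt0.
apply: ge_ereal_sup => _ [X [finX XI] <-].
rewrite fsbig_finite//= sumEFin lee_fin.
under eq_bigr do rewrite e.
rewrite -mulr_sumr.
have /= := H (fset_set X) I (fset_uniq _).
suff h : forall J, J \in fset_set X -> dset J `<=` (dset I : set R).
  by move=> /(_ h); lra.
by move=> J; rewrite in_fset_set// inE => /XI.
Qed.

(** * The positive operator *)

Definition dyadic_enum (n : nat) : dyadic := odflt (0, 0) (choice.unpickle n).

(** Discards the codes that only reach an interval by the default value of
    [dyadic_enum], so that every interval is enumerated once. *)
Definition dyadic_code (n : nat) : bool := choice.pickle (dyadic_enum n) == n.

Definition dyadic_prefix (n : nat) : seq dyadic :=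
  [seq dyadic_enum i | i <- index_iota 0 n & dyadic_code i].

Lemma dyadic_prefix_uniq n : uniq (dyadic_prefix n).
Proof.
rewrite map_inj_in_uniq ?filter_uniq ?iota_uniq// => i j.
by rewrite !mem_filter => /andP[/eqP ci _] /andP[/eqP cj _] e; rewrite -ci -cj e.
Qed.

Lemma sum_dyadic_prefix (R : realType) (a : dyadic -> \bar R) n :
  (\sum_(I <- dyadic_prefix n) a I =
   \sum_(0 <= i < n | dyadic_code i) a (dyadic_enum i))%E.
Proof. by rewrite big_map big_filter. Qed.

Lemma esum_dyadic (R : realType) (a : dyadic -> \bar R) :
  (forall I, 0 <= a I)%E ->
  (\sum_(I <- dyadic_prefix n) a I)%E @[n --> \oo] -->
    \esum_(I in [set: dyadic]) a I.
Proof.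
move=> a0.
have -> : [set: dyadic] = [set dyadic_enum x | x in fun x => dyadic_code x].
  apply/esym/seteqP; split => // I _.
  exists (choice.pickle I); last by rewrite /dyadic_enum choice.pickleK.
  by rewrite /dyadic_code /dyadic_enum choice.pickleK /=.
rewrite esum_pred_image//; last first.
  move=> i j; rewrite !inE => /eqP ci /eqP cj e.
  by rewrite -ci -cj e.
under eq_cvg do rewrite sum_dyadic_prefix.
by apply: is_cvg_ereal_nneg_natsum_cond.
Qed.

Lemma nondecreasing_prefix (R : realType) (a : dyadic -> \bar R) :
  (forall I, 0 <= a I)%E ->
  {homo (fun n => \sum_(I <- dyadic_prefix n) a I)%E : n m /
    (n <= m)%N >-> (n <= m)%E}.
Proof.
move=> a0 n m nm; rewrite !sum_dyadic_prefix.
exact: (ereal_nondecreasing_series (fun i _ _ => a0 (dyadic_enum i)) nm).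
Qed.

Lemma measurable_esum_dyadic (R : realType) (h : dyadic -> R -> \bar R) :
  (forall I x, 0 <= h I x)%E -> (forall I, measurable_fun [set: R] (h I)) ->
  measurable_fun [set: R] (fun x => \esum_(I in [set: dyadic]) h I x).
Proof.
move=> h0 mh.
apply: (emeasurable_fun_cvg (fun n x => \sum_(I <- dyadic_prefix n) h I x)%E).
  by move=> n; exact: emeasurable_sum.
by move=> x _; exact: esum_dyadic.
Qed.

Lemma lambdaE (R : realType) (u v w : R -> R) (t : R) (I : dyadic) :
  locint (winv u) -> locint (vw2t v w t) ->
  (forall x, 0 < u x) -> (forall x, 0 < vw2t v w t x) ->
  lambda u v w t I = 4 * dlen I ^+ 2 *
    pos_coef (winv u) (vw2t v w t) (multiplier_coef w t) I.
Proof.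
move=> la lb u0 b0; rewrite /lambda /pos_coef /multiplier_coef !avgE !DeltaE.
have L0 := dlen_gt0 R I.
have A0 := mass_gt0 I la (winv_gt0 u0); have B0 := mass_gt0 I lb b0.
rewrite !normrM !normfV !(ger0_norm (ltW L0)) (ger0_norm (ler0n _ 2)).
move: (_ `^ t)^-1 => z.
by field; rewrite !gt_eqF.
Qed.

Lemma pos_coef_ge0 (R : realType) (a b w : R -> R) (t : R) (I : dyadic) :
  locint a -> locint b -> (forall x, 0 < a x) -> (forall x, 0 < b x) ->
  0 <= pos_coef a b (multiplier_coef w t) I.
Proof.
move=> la lb a0 b0; rewrite /pos_coef.
have L0 := dlen_gt0 R I; have A0 := mass_gt0 I la a0; have B0 := mass_gt0 I lb b0.
by rewrite divr_ge0 ?(ltW L0)// !mulr_ge0 ?multiplier_coef_ge0// invr_ge0 ltW.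
Qed.

Lemma pos_termE (R : realType) (u v w f : R -> R) (t x : R) (I : dyadic) :
  locint (winv u) -> locint (vw2t v w t) ->
  (forall x, 0 < u x) -> (forall x, 0 < vw2t v w t x) ->
  pos_term u v w t f x I = w x `^ t *
   ((4 * pos_coef (winv u) (vw2t v w t) (multiplier_coef w t) I * mass f I) *
     \1_(dset I) x).
Proof.
move=> la lb u0 b0; rewrite /pos_term lambdaE// avgE.
by field; rewrite gt_eqF// dlen_gt0.
Qed.

Lemma normr_pos_termE (R : realType) (u v w f : R -> R) (t x : R) (I : dyadic) :
  locint (winv u) -> locint (vw2t v w t) ->
  (forall x, 0 < u x) -> (forall x, 0 < vw2t v w t x) ->
  `|pos_term u v w t f x I| = w x `^ t *
   ((4 * pos_coef (winv u) (vw2t v w t) (multiplier_coef w t) I * `|mass f I|) *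
     \1_(dset I) x).
Proof.
move=> la lb u0 b0; rewrite pos_termE//.
have := pos_coef_ge0 w t I la lb (winv_gt0 u0) b0.
move: (pos_coef _ _ _ _) => p p0; rewrite !normrM indicE.
by rewrite (ger0_norm (powR_ge0 _ _)) !(ger0_norm (ler0n _ _)) (ger0_norm p0).
Qed.

Lemma measurable_pos_term (R : realType) (u v w f : R -> R) (t : R) (I : dyadic) :
  measurable_fun [set: R] w ->
  measurable_fun [set: R] (fun x => pos_term u v w t f x I).
Proof.
move=> mw; rewrite /pos_term; apply: measurable_funM.
  do 3 (apply: measurable_funM => //).
  by apply: (measurableT_comp (measurable_powR _)).
by apply: measurable_indic; exact: measurable_dset.
Qed.

Lemma measurable_pos_op (R : realType) (u v w f : R -> R) (t : R) :
  measurable_fun [set: R] w -> measurable_fun [set: R] (pos_op u v w t f).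
Proof.
move=> mw; rewrite /pos_op /=.
have mt (I : dyadic) :=
  measurable_EFin (D := [set: R]) (@measurable_pos_term R u v w f t I mw).
apply: (measurableT_comp (@fine_measurable R _ measurableT)).
apply: emeasurable_funB; apply: measurable_esum_dyadic => //.
- move=> I; have := measurable_funepos (mt I); congr (measurable_fun _ _).
  by apply/funext => x; rewrite !funeposE.
- move=> I; have := measurable_funeneg (mt I); congr (measurable_fun _ _).
  by apply/funext => x; rewrite !funenegE.
Qed.

(** The same duality as in [multiplier_bound], with the partial sum of the
    positive operator in the role of k. *)
Lemma positive_partial_bound (R : realType) (a b f : R -> R) (w : R -> R)
   (t C : R) (F : seq dyadic) :
  (forall x, 0 < a x) -> (forall x, 0 < b x) -> locint a -> locint b ->
  0 <= C -> positive_bound a b (multiplier_coef w t) (C / 4) -> uniq F -> L2 (winv a) f ->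
  \int[leb]_x ((\sum_(I <- F) (4 * pos_coef a b (multiplier_coef w t) I * `|mass f I|)
      * \1_(dset I) x) ^+ 2 * b x) <= C ^+ 2 * sqnorm (winv a) f.
Proof.
move=> a0 b0 la lb C0 H uF Lf.
pose c I := 4 * pos_coef a b (multiplier_coef w t) I * `|mass f I|.
pose k (x : R) : R := \sum_(I <- F) c I * \1_(dset I) x.
rewrite -[X in X <= _]/(\int[leb]_x (k x ^+ 2 * b x)).
have tk : test_function k by apply: test_sum => I; exact: test_indic.
have [Lk Nk] := test_mul_L2 b0 lb tk.
have := H F _ _ uF Lf Lk; rewrite Nk.
set N := \int[leb]_x _ => h.
have N0 : 0 <= N by apply: Rintegral_ge0 => x _; rewrite mulr_ge0 ?sqr_ge0// ltW.
have S0 := sqnorm_ge0 f (winv_gt0 a0).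
rewrite -(sqr_sqrtr S0) -exprMn; apply: le_sqr_of_le_mul_sqrt => //.
  by rewrite mulr_ge0// sqrtr_ge0.
have NE : N = \sum_(I <- F) c I * mass (fun x => k x * b x) I.
  have lkb := test_locint tk lb.
  have := Rintegral_test_sum F c (test_indic R) lkb.
  under [X in _ = X -> _]eq_bigr do rewrite Rintegral_indic.
  by move=> <-; apply: eq_Rintegral => x _; rewrite -/(k x) expr2 mulrA.
rewrite {1}NE.
apply: (@le_trans _ _
  (4 * (C / 4 * Num.sqrt (sqnorm (winv a) f) * Num.sqrt N))); last first.
  by rewrite le_eqVlt; apply/orP; left; apply/eqP; field.
apply: le_trans (ler_wpM2l _ h) => //.
rewrite mulr_sumr; apply: ler_sum => I _; rewrite /c.
have := pos_coef_ge0 w t I la lb a0 b0; move: (pos_coef _ _ _ _) => p p0.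
by rewrite !mulrA ler_wpM2l ?ler_norm// !mulr_ge0.
Qed.

Lemma ae_imply (R : realType) (P Q : R -> Prop) :
  (forall x, P x -> Q x) -> (\forall x \ae @lebesgue_measure R, P x) ->
  \forall x \ae @lebesgue_measure R, Q x.
Proof. by move=> PQ; apply: (filterS (Filter := ae_filter_ringOfSetsType leb)). Qed.

Lemma pos_op_pointwise (R : realType) (u v w f : R -> R) (t x s : R) :
  (\esum_(I in [set: dyadic]) `|(pos_term u v w t f x I)%:E| <= s%:E)%E ->
  summable [set: dyadic] (fun I => (pos_term u v w t f x I)%:E) /\
  `|pos_op u v w t f x| <= s.
Proof.
move=> Es; have Sy : summable [set: dyadic] (fun I => (pos_term u v w t f x I)%:E).
  by apply: le_lt_trans Es _; rewrite ltry.
split => //; rewrite /pos_op.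
set a := fun I => _; set p := esum _ _; set q := (X in (p - X)%E).
have p0 : (0 <= p)%E by apply: esum_ge0 => I _; exact: funepos_ge0.
have q0 : (0 <= q)%E by apply: esum_ge0 => I _; exact: funeneg_ge0.
have ps : (p <= s%:E)%E.
  apply: le_trans Es; apply: le_esum => I _.
  by rewrite funeposE /a ge_max abse_ge0 lee_abs.
have qs : (q <= s%:E)%E.
  apply: le_trans Es; apply: le_esum => I _.
  by rewrite funenegE /a ge_max abse_ge0 -abseN lee_abs.
move: p q p0 q0 ps qs => [p| |] [q| |]//=; rewrite ?leye_eq//.
rewrite !lee_fin => p0 q0 ps qs; rewrite ler_norml; apply/andP; split; lra.
Qed.

(** The squares of the partial sums of absolute values increase with the
    family, so monotone convergence bounds the integral of their limit; finiteness
    almost everywhere of this limit is the absolute convergence of the series. *)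
Lemma pos_op_of_positive (R : realType) (u v w : R -> R) (t C : R) :
  (forall x, 0 < u x) -> (forall x, 0 < v x) -> (forall x, 0 < w x) ->
  measurable_fun [set: R] u -> measurable_fun [set: R] v ->
  measurable_fun [set: R] w ->
  locint (winv u) -> locint (vw2t v w t) -> 0 <= C ->
  positive_bound (winv u) (vw2t v w t) (multiplier_coef w t) (C / 4) ->
  pos_op_bound u v w t C.
Proof.
move=> u0 v0 w0 mu mv mw la lb C0 H; split => // f /(in_L2P f mu u0) Lf.
have b0 x : 0 < vw2t v w t x by rewrite mulr_gt0// powR_gt0.
have a0 := winv_gt0 u0.
have Lf' : L2 (winv (winv u)) f by rewrite winvK.
pose S n x := \sum_(I <- dyadic_prefix n) `|pos_term u v w t f x I|.
(* At a point where the limit g of G is finite, the partial sums S stay below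
   sqrt (g / v). *)
pose G n x := (S n x ^+ 2 * v x)%:E.
have mt I := @measurable_pos_term R u v w f t I mw.
have mG n : measurable_fun [set: R] (G n).
  apply: measurable_EFin; apply: measurable_funM => //; apply: measurable_funX.
  by apply: measurable_sum => I; exact: measurableT_comp.
have G0 n x : (0 <= G n x)%E.
  by rewrite lee_fin mulr_ge0 ?sqr_ge0// ltW.
have S0 n x : 0 <= S n x by apply: sumr_ge0.
have ndS x n m : (n <= m)%N -> S n x <= S m x.
  move=> nm; rewrite -lee_fin /S -!sumEFin.
  by apply: (nondecreasing_prefix (fun I => _) nm) => I; rewrite lee_fin.
have ndG x : {homo G^~ x : n m / (n <= m)%N >-> (n <= m)%E}.
  move=> n m nm; rewrite lee_fin ler_wpM2r ?(ltW (v0 x))//.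
  by rewrite ler_pXn2r ?nnegrE// ndS.
have cvgG x : G n x @[n --> \oo] --> limn (G^~ x).
  exact: ereal_nondecreasing_is_cvgn.
pose K := C ^+ 2 * sqnorm u f.
have iG n : (\int[leb]_x G n x <= K%:E)%E.
  pose c I := 4 * pos_coef (winv u) (vw2t v w t) (multiplier_coef w t) I * `|mass f I|.
  pose k (x : R) : R := \sum_(I <- dyadic_prefix n) c I * \1_(dset I) x.
  have tk : test_function k by apply: test_sum; exact: test_indic.
  have intk : leb.-integrable [set: R] (EFin \o (fun x => k x ^+ 2 * vw2t v w t x)).
    have := test_integrable (testM tk tk) lb.
    by apply: eq_integrable => // x _ /=; rewrite expr2.
  have -> : (\int[leb]_x G n x = \int[leb]_x (k x ^+ 2 * vw2t v w t x)%:E)%E.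
    apply: eq_integral => x _; congr EFin; rewrite /S.
    under eq_bigr do rewrite normr_pos_termE//.
    by rewrite -mulr_sumr /vw2t powR2M -/(k x); ring.
  rewrite -(fineK (integrable_fin_num measurableT intk)) lee_fin.
  have := positive_partial_bound a0 b0 la lb C0 H (dyadic_prefix_uniq n) Lf'.
  by rewrite winvK.
have iG' : (\int[leb]_x limn (G^~ x) <= K%:E)%E.
  rewrite (monotone_convergence leb measurableT mG (fun n x _ => G0 n x)
    (fun x _ => ndG x)).
  apply: lime_le; last by near=> n; exact: iG.
  apply: ereal_nondecreasing_is_cvgn => n m nm.
  exact: (ge0_le_integral leb measurableT (fun x _ => G0 n x) (mG n) (mG m)
    (fun x _ => ndG x n m nm)).
have mGl : measurable_fun [set: R] (fun x => limn (G^~ x)).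
  by apply: (emeasurable_fun_cvg G) => // x _; exact: cvgG.
have Gl0 x : (0 <= limn (G^~ x))%E.
  by apply: lime_ge; [exact: cvgP (cvgG x)|near=> n; exact: G0].
have intG : leb.-integrable [set: R] (fun x => limn (G^~ x)).
  apply/integrableP; split => //.
  under eq_integral do rewrite gee0_abs//.
  by apply: le_lt_trans iG' _; rewrite ltry.
have aeG : \forall x \ae leb, limn (G^~ x) \is a fin_num.
  by have := integrable_ae measurableT intG; apply: filterS => x; apply.
have pw x : limn (G^~ x) \is a fin_num ->
    summable [set: dyadic] (fun I => (pos_term u v w t f x I)%:E) /\
    ((`|pos_op u v w t f x| ^+ 2 * v x)%:E <= limn (G^~ x))%E.
  move=> finG; have := Gl0 x; have := cvgG x; rewrite -(fineK finG).
  set g := fine _ => cg g0.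
  have Gg n : S n x ^+ 2 * v x <= g.
    rewrite -lee_fin -[leLHS]/(G n x).
    have -> : g%:E = ereal_sup (range (G^~ x)).
      by apply: cvg_unique cg _ => //; exact: ereal_nondecreasing_cvgn.
    by apply: ereal_sup_ubound; exists n.
  have gv0 : 0 <= g / v x by rewrite divr_ge0 ?(ltW (v0 x)).
  have Sg n : S n x <= Num.sqrt (g / v x).
    rewrite -[leLHS]ger0_norm// -sqrtr_sqr ler_wsqrtr//.
    by rewrite ler_pdivlMr.
  have Es : (\esum_(I in [set: dyadic]) `|(pos_term u v w t f x I)%:E| <=
      (Num.sqrt (g / v x))%:E)%E.
    have cE := esum_dyadic (fun I => abse_ge0 (pos_term u v w t f x I)%:E).
    rewrite -(cvg_lim _ cE)//; apply: lime_le; first exact: cvgP cE.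
    by near=> n; rewrite sumEFin lee_fin; exact: Sg.
  have [Sx Px] := pos_op_pointwise Es; split => //.
  rewrite lee_fin -ler_pdivlMr// -(sqr_sqrtr gv0).
  by rewrite ler_pXn2r ?nnegrE// sqrtr_ge0.
split; first by apply: ae_imply aeG => x /pw[].
rewrite (norm2E Lf) /norm2.
have -> : (C%:E * (Num.sqrt (sqnorm u f))%:E)%E = sqrte K%:E.
  by rewrite /= /K sqrtrM ?sqr_ge0// sqrtr_sqr ger0_norm// EFinM.
rewrite lee_sqrt; last by rewrite lee_fin mulr_ge0 ?sqr_ge0 ?sqnorm_ge0.
apply: le_trans iG'; apply: ae_ge0_le_integral => //.
- by move=> x _; rewrite lee_fin mulr_ge0 ?sqr_ge0// ltW.
- apply: measurable_EFin; apply: measurable_funM => //; apply: measurable_funX.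
  by apply: measurableT_comp => //; exact: measurable_pos_op.
- by apply: ae_imply aeG => x /pw[_ h] _.
Unshelve. all: by end_near.
Qed.

(** On |f| every term of the series is nonnegative, so the operator
    dominates its partial sums; these are paired with |h| by Cauchy-Schwarz. *)
Lemma positive_of_pos_op (R : realType) (u v w : R -> R) (t C : R) :
  (forall x, 0 < u x) -> (forall x, 0 < v x) -> (forall x, 0 < w x) ->
  measurable_fun [set: R] u -> measurable_fun [set: R] v ->
  measurable_fun [set: R] w ->
  locint (winv u) -> locint (vw2t v w t) ->
  pos_op_bound u v w t C ->
  positive_bound (winv u) (vw2t v w t) (multiplier_coef w t) (C / 4).
Proof.
move=> u0 v0 w0 mu mv mw la lb [C0 H] F f h uF Lf Lh.
have b0 x : 0 < vw2t v w t x by rewrite mulr_gt0// powR_gt0.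
have a0 := winv_gt0 u0.
have [lf _] := mass_sqr_le a0 la Lf; have [lh _] := mass_sqr_le b0 lb Lh.
rewrite winvK in Lf *.
have [Lf' Nf] := L2_norm Lf; have [Lh' Nh] := L2_norm Lh.
have lf' : locint (fun x => `|f x|).
  by have := mass_sqr_le a0 la; rewrite winvK => /(_ _ Lf')[].
have lh' : locint (fun x => `|h x|) by have [] := mass_sqr_le b0 lb Lh'.
have mass_norm g I : locint g -> locint (fun x => `|g x|) ->
    `|mass g I| <= mass (fun x => `|g x|) I.
  move=> lg lg'; rewrite /mass; apply: le_normr_Rintegral.
    exact: measurable_dset.
  exact: locint_dset.
have mass0 (g : R -> R) I : 0 <= mass (fun x => `|g x|) I by apply: Rintegral_ge0.
pose c I := 4 * pos_coef (winv u) (vw2t v w t) (multiplier_coef w t) I *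
  mass (fun x => `|f x|) I.
have pw0 I := @pos_coef_ge0 R (winv u) (vw2t v w t) w t I la lb a0 b0.
have c0 I : 0 <= c I.
  by apply: mulr_ge0 => //; apply: mulr_ge0 => //; exact: pw0.
pose k (x : R) : R := \sum_(I <- F) c I * \1_(dset I) x.
have tk : test_function k by apply: test_sum; exact: test_indic.
have k0 x : 0 <= k x.
  by apply: sumr_ge0 => I _; rewrite mulr_ge0// indicE.
have intk : leb.-integrable [set: R] (EFin \o (fun x => k x ^+ 2 * vw2t v w t x)).
  have := test_integrable (testM tk tk) lb.
  by apply: eq_integrable => // x _ /=; rewrite expr2.
have [aeS] := H _ ((in_L2P _ mu u0).2 Lf').
rewrite (norm2E Lf') Nf => le.
have kle : Num.sqrt (\int[leb]_x (k x ^+ 2 * vw2t v w t x)) <=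
    C * Num.sqrt (sqnorm u f).
  rewrite -lee_fin EFinM; apply: le_trans le.
  rewrite -[leLHS]/(sqrte (\int[leb]_x (k x ^+ 2 * vw2t v w t x))%:E) /norm2.
  rewrite lee_sqrt; last first.
    by apply: integral_ge0 => x _; rewrite lee_fin mulr_ge0 ?sqr_ge0// ltW.
  rewrite /Rintegral (fineK (integrable_fin_num measurableT intk)).
  apply: ae_ge0_le_integral => //.
  - by move=> x _; rewrite lee_fin mulr_ge0 ?sqr_ge0// ltW.
  - by case/integrableP: intk.
  - by move=> x _; rewrite lee_fin mulr_ge0 ?sqr_ge0// ltW.
  - apply: measurable_EFin; apply: measurable_funM => //; apply: measurable_funX.
    by apply: measurableT_comp => //; exact: measurable_pos_op.
  apply: ae_imply aeS => x Sx _; rewrite lee_fin.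
  have t0 I : 0 <= pos_term u v w t (fun x => `|f x|) x I.
    rewrite pos_termE//; apply: mulr_ge0; first exact: powR_ge0.
    by apply: mulr_ge0; [exact: c0|rewrite indicE].
  rewrite /vw2t powR2M [leLHS](_ : _ = (w x `^ t * k x) ^+ 2 * v x); last by ring.
  rewrite ler_wpM2r ?(ltW (v0 x))// ler_pXn2r ?nnegrE ?mulr_ge0 ?powR_ge0//.
  apply: le_trans (ler_norm _); rewrite /pos_op.
  pose A (I : dyadic) := (pos_term u v w t (fun x => `|f x|) x I)%:E.
  rewrite -/A.
  have -> : \esum_(I in [set: dyadic]) (A^\+)%E I = \esum_(I in [set: dyadic]) A I.
    apply: eq_esum => I _; rewrite funeposE; apply/max_idPl.
    by rewrite lee_fin t0.
  have -> : \esum_(I in [set: dyadic]) (A^\-)%E I = 0%E.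
    apply: esum1 => I _; rewrite funenegE; apply/max_idPr.
    by rewrite leeNl oppe0 lee_fin t0.
  rewrite sube0 -lee_fin fineK.
    apply: esum_ge; exists [set` F].
      by split; [exact: finite_seq|].
    rewrite -fsbig_seq// sumEFin lee_fin mulr_sumr.
    by apply: ler_sum => I _; rewrite pos_termE.
  move: Sx; rewrite summableE; congr (_ \is a fin_num); apply: eq_esum => I _.
  by rewrite gee0_abs// lee_fin t0.
have mk : measurable_fun [set: R] k by case: tk.
have [_ cs] := cauchy_schwarz measurableT b0 mk Lh'.1 intk Lh'.2.
have ckh : \int[leb]_x (k x * `|h x|) = \sum_(I <- F) c I * mass (fun x => `|h x|) I.
  rewrite (Rintegral_test_sum F c (test_indic R) lh').
  by apply: eq_bigr => I _; rewrite Rintegral_indic.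
have kh : \sum_(I <- F) c I * mass (fun x => `|h x|) I <=
    C * Num.sqrt (sqnorm u f) * Num.sqrt (sqnorm (winv (vw2t v w t)) h).
  rewrite -ckh -Nh; apply: (le_trans (ler_norm _)); rewrite -sqrtr_sqr.
  apply: (@le_trans _ _ (Num.sqrt (\int[leb]_x (k x ^+ 2 * vw2t v w t x)) *
     Num.sqrt (sqnorm (winv (vw2t v w t)) (fun x => `|h x|)))).
    rewrite -sqrtrM; first exact: ler_wsqrtr.
    by apply: Rintegral_ge0 => x _; rewrite mulr_ge0 ?sqr_ge0// ltW.
  by rewrite ler_wpM2r// sqrtr_ge0.
suff : 4 * \sum_(I <- F) pos_coef (winv u) (vw2t v w t) (multiplier_coef w t) I *
    `|mass f I| * `|mass h I| <= \sum_(I <- F) c I * mass (fun x => `|h x|) I.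
  by lra.
rewrite mulr_sumr; apply: ler_sum => I _; rewrite /c.
have := pw0 I; move: (pos_coef _ _ _ _) => p p0.
rewrite !mulrA; apply: ler_pM => //; rewrite ?mulr_ge0//; last exact: mass_norm.
by apply: ler_wpM2l; [rewrite mulr_ge0|exact: mass_norm].
Qed.

(** * The theorem for everywhere positive weights *)

Lemma norm2_ge0 (R : realType) (u f : R -> R) : (0 <= norm2 u f)%E.
Proof. exact: sqrte_ge0. Qed.

Lemma haar_mult_boundW (R : realType) (u v w : R -> R) (t C C' : R) :
  C <= C' -> haar_mult_bound u v w t C -> haar_mult_bound u v w t C'.
Proof.
move=> CC [C0 H]; split; first exact: le_trans CC.
move=> sigma F f sg lf Lf; apply: le_trans (H _ F _ sg lf Lf) _.
by apply: lee_wpmul2r; [exact: norm2_ge0|rewrite lee_fin].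
Qed.

Record positive_weights (R : realType) (u v w : R -> R) : Prop :=
  PositiveWeights {
    pw_u : forall x, 0 < u x; pw_v : forall x, 0 < v x; pw_w : forall x, 0 < w x;
    pw_mu : measurable_fun [set: R] u; pw_mv : measurable_fun [set: R] v;
    pw_lw : locint w }.

Lemma positive_weights_vw2t (R : realType) (u v w : R -> R) (t : R) :
  positive_weights u v w -> forall x, 0 < vw2t v w t x.
Proof. by move=> W x; rewrite mulr_gt0 ?(pw_v W)// powR_gt0// (pw_w W). Qed.

(** The best constants may fail to be attained, since an admissible Carleson
    constant is positive, hence the formulation with arbitrary admissible ones. *)
Lemma haar_mult_of_conditions (R : realType) (u v w : R -> R) (t j C2 C3 C4 : R) :
  positive_weights u v w ->
  (joint_const u v w t <= j%:E)%E ->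
  carleson_bound (winv u) (vw2t v w t) w t C2 ->
  carleson_bound (vw2t v w t) (winv u) w t C3 ->
  pos_op_bound u v w t C4 ->
  haar_mult_bound u v w t (Num.sqrt j + Num.sqrt C2 + Num.sqrt C3 + C4).
Proof.
move=> W Hj H2 H3 H4; have b0 := positive_weights_vw2t t W.
case: W => u0 v0 w0 mu mv lw; have a0 := winv_gt0 u0.
have mw := locint_measurable lw.
have [la lb] := locint_of_joint u0 v0 w0 mu mv lw (le_lt_trans Hj (ltry _)).
have C40 : 0 <= C4 by case: H4.
move/(joint_boundP _ la lb) : Hj => Hj.
move/(carleson_boundP _ _ _ la b0 lb) : H2 => [C20 H2].
move/(carleson_boundP _ _ _ lb a0 la) : H3 => [C30 H3].
have {}H4 := positive_of_pos_op u0 v0 w0 mu mv mw la lb H4.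
have C24 : 0 < C2 / 4 by rewrite divr_gt0.
have C34 : 0 < C3 / 4 by rewrite divr_gt0.
have := bilinear_bound_of_conditions a0 b0 la lb (multiplier_coef_ge0 w t)
  C24 C34 Hj H2 H3 H4.
have half C : 0 < C -> 2 * Num.sqrt (C / 4) = Num.sqrt C.
  move=> C0; have CE : C = 2 ^+ 2 * (C / 4) by field.
  by rewrite [in RHS]CE [in RHS]sqrtrM ?sqr_ge0// sqrtr_sqr ger0_norm.
rewrite !half// => H.
apply: (@haar_mult_boundW _ _ _ _ _
   (Num.sqrt j + Num.sqrt C2 + Num.sqrt C3 + C4 / 4)); first by lra.
by apply: haar_mult_of_bilinear => //; rewrite !addr_ge0 ?sqrtr_ge0 ?divr_ge0.
Qed.

Lemma conditions_of_haar_mult (R : realType) (u v w : R -> R) (t C : R) :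
  positive_weights u v w -> 0 < C -> haar_mult_bound u v w t C ->
  [/\ (joint_const u v w t <= (C ^+ 2)%:E)%E,
      carleson_bound (winv u) (vw2t v w t) w t (4 * C ^+ 2),
      carleson_bound (vw2t v w t) (winv u) w t (4 * C ^+ 2)
    & pos_op_bound u v w t (16 * C)].
Proof.
move=> W C0 H; have b0 := positive_weights_vw2t t W.
case: W => u0 v0 w0 mu mv lw; have a0 := winv_gt0 u0.
have mw := locint_measurable lw.
have Hj := joint_of_haar_mult u0 v0 w0 mu mv lw H.
have [la lb] := locint_of_joint u0 v0 w0 mu mv lw (le_lt_trans Hj (ltry _)).
have HB := bilinear_of_haar_mult u0 v0 w0 mu lw la lb H.
have C0' := ltW C0; have c0 := multiplier_coef_ge0 w t.
have C24 : 0 < 4 * C ^+ 2 by rewrite mulr_gt0// exprn_gt0.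
have CE : C ^+ 2 = 4 * C ^+ 2 / 4 by field.
split => //.
- apply/(carleson_boundP _ _ _ la b0 lb); split; rewrite // -CE.
  exact: bilinear_carleson.
- apply/(carleson_boundP _ _ _ lb a0 la); split; rewrite // -CE.
  by apply: bilinear_carleson => //; exact: bilinear_boundC.
- apply: pos_op_of_positive => //; first by rewrite mulr_ge0.
  have -> : 16 * C / 4 = 4 * C by field.
  by apply: positive_bound_of_bilinear => //; exact/joint_boundP.
Qed.

Lemma ereal_inf_const_ge0 (R : realType) (P : R -> Prop) :
  (forall C, P C -> 0 <= C) ->
  (0 <= ereal_inf [set C%:E | C in [set C : R | P C]])%E.
Proof. by move=> P0; apply: le_ereal_inf_tmp => _ [C /P0 C0 <-]; rewrite lee_fin. Qed.

Lemma ereal_inf_near (R : realType) (P : R -> Prop) (e : R) : 0 < e ->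
  (0 <= ereal_inf [set C%:E | C in [set C : R | P C]] < +oo)%E ->
  exists2 C, P C & C <= fine (ereal_inf [set C%:E | C in [set C : R | P C]]) + e.
Proof.
move=> e0; set i := ereal_inf _ => /andP[i0 iy].
have ifin : i \is a fin_num by rewrite ge0_fin_numE.
have : (i < (fine i + e)%:E)%E by rewrite -[ltLHS]fineK// lte_fin ltrDl.
by move=> /ereal_inf_lt[_ [C PC <-]]; rewrite lte_fin => /ltW; exists C.
Qed.

Definition conditions_size (R : realType) (u v w : R -> R) (t : R) : \bar R :=
  (sqrte (joint_const u v w t)
   + sqrte (carleson_const (winv u) (vw2t v w t) w t)
   + sqrte (carleson_const (vw2t v w t) (winv u) w t)
   + pos_op_norm u v w t)%E.

Lemma joint_const_ge0 (R : realType) (u v w : R -> R) (t : R) :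
  positive_weights u v w -> (0 <= joint_const u v w t)%E.
Proof.
move=> W; have b0 := positive_weights_vw2t t W.
case: W => u0 v0 w0 mu mv lw.
have mb := measurable_vw2t t mv (locint_measurable lw).
pose I : dyadic := (0, 0).
have h0 : (0 <= avge (winv u) I * avge (vw2t v w t) I *
    ((avg w I `^ (2 * t))^-1)%:E)%E.
  apply: mule_ge0; last by rewrite lee_fin invr_ge0 powR_ge0.
  apply: mule_ge0; apply: ltW; apply: avge_gt0 => //.
    exact: measurable_winv.
  exact: winv_gt0.
by apply: le_trans h0 _; apply: ereal_sup_ubound; exists I.
Qed.

Lemma haar_mult_norm_le (R : realType) (u v w : R -> R) (t : R) :
  positive_weights u v w ->
  (haar_mult_norm u v w t <= conditions_size u v w t)%E.
Proof.
move=> W; have J0 := joint_const_ge0 t W.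
rewrite /conditions_size.
have K2 : (0 <= carleson_const (winv u) (vw2t v w t) w t)%E.
  by apply: ereal_inf_const_ge0 => C [/ltW].
have K3 : (0 <= carleson_const (vw2t v w t) (winv u) w t)%E.
  by apply: ereal_inf_const_ge0 => C [/ltW].
have K4 : (0 <= pos_op_norm u v w t)%E by apply: ereal_inf_const_ge0 => C [].
have [->|Jy] := eqVneq (joint_const u v w t) +oo%E.
  by rewrite /= !addye ?leey// -ltNye (lt_le_trans (ltNy0)) ?sqrte_ge0.
have [->|K2y] := eqVneq (carleson_const (winv u) (vw2t v w t) w t) +oo%E.
  by rewrite addey ?addye ?leey// -ltNye (lt_le_trans (ltNy0)) ?sqrte_ge0.
have [->|K3y] := eqVneq (carleson_const (vw2t v w t) (winv u) w t) +oo%E.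
  rewrite addey ?addye ?leey// -ltNye (lt_le_trans (ltNy0))//.
  by rewrite adde_ge0 ?sqrte_ge0.
have [->|K4y] := eqVneq (pos_op_norm u v w t) +oo%E.
  rewrite addey ?leey// -ltNye (lt_le_trans (ltNy0))//.
  by rewrite !adde_ge0 ?sqrte_ge0.
rewrite -!ltey in Jy K2y K3y K4y.
have root_near (k : \bar R) (e : R) : 0 < e -> (0 <= k < +oo)%E ->
    fine k + (2 * Num.sqrt (fine k) * e + e ^+ 2) = (Num.sqrt (fine k) + e) ^+ 2.
  move=> e0 /andP[k0 _]; rewrite -{1}(sqr_sqrtr (fine_ge0 k0)); ring.
have sqrteE (k : \bar R) : (0 <= k < +oo)%E -> sqrte k = (Num.sqrt (fine k))%:E.
  by move=> /andP[k0 ky]; rewrite -[in LHS](@fineK _ k) ?ge0_fin_numE.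
have gap (k e : R) : 0 < e -> 0 < 2 * Num.sqrt k * e + e ^+ 2.
  by move=> e0; rewrite ltr_wpDl ?exprn_gt0// !mulr_ge0 ?sqrtr_ge0// ltW.
have root_le (k : \bar R) (e C : R) : 0 < e -> (0 <= k < +oo)%E ->
    C <= fine k + (2 * Num.sqrt (fine k) * e + e ^+ 2) ->
    Num.sqrt C <= Num.sqrt (fine k) + e.
  move=> e0 hk; rewrite root_near// => /ler_wsqrtr /le_trans; apply.
  by rewrite sqrtr_sqr ger0_norm// addr_ge0 ?sqrtr_ge0// ltW.
rewrite !sqrteE ?J0 ?K2 ?K3//.
set k2 := carleson_const _ _ _ _ in K2 K2y *.
set k3 := carleson_const _ _ _ _ in K3 K3y *.
set k4 := pos_op_norm _ _ _ _ in K4 K4y *.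
have k4fin : k4 \is a fin_num by rewrite ge0_fin_numE.
rewrite -(fineK k4fin) -!EFinD.
apply/lee_addgt0Pr => e e0; rewrite -EFinD.
(* Three of the four constants are only approximated, each within e / 3. *)
have d0 : 0 < e / 3 by rewrite divr_gt0.
have hk2 : (0 <= k2 < +oo)%E by rewrite K2.
have hk3 : (0 <= k3 < +oo)%E by rewrite K3.
have hk4 : (0 <= k4 < +oo)%E by rewrite K4.
have [C2 H2 /(root_le _ _ _ d0 hk2) C2E] := ereal_inf_near (gap (fine k2) _ d0) hk2.
have [C3 H3 /(root_le _ _ _ d0 hk3) C3E] := ereal_inf_near (gap (fine k3) _ d0) hk3.
have [C4 H4 C4E] := ereal_inf_near d0 hk4.
have Jj : (joint_const u v w t <= (fine (joint_const u v w t))%:E)%E.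
  by rewrite fineK// ge0_fin_numE.
have := haar_mult_of_conditions W Jj H2 H3 H4.
set C := _ + C4 => HC; apply: ge_ereal_inf; exists C%:E; first by exists C.
by rewrite lee_fin /C; lra.
Qed.

(** Bounds by sqrt C_1 <= C, sqrt C_2 <= 2 C, sqrt C_3 <= 2 C and C_4 <= 16 C,
    applied to constants slightly above an admissible C because C may be 0. *)
Lemma conditions_size_le (R : realType) (u v w : R -> R) (t : R) :
  positive_weights u v w ->
  (conditions_size u v w t <= 21%:E * haar_mult_norm u v w t)%E.
Proof.
move=> W; rewrite -lee_pdivrMl//; apply: le_ereal_inf_tmp => _ [C [C0 H] <-].
rewrite lee_pdivrMl//; apply/lee_addgt0Pr => e e0; rewrite -EFinM -EFinD.
(* The slack e is spread over the factor 21. *)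
pose C' := C + e / 21.
have C'0 : 0 < C' by rewrite ltr_wpDl// divr_gt0.
have -> : 21 * C + e = C' + 2 * C' + 2 * C' + 16 * C' by rewrite /C'; field.
have HC : haar_mult_bound u v w t C'.
  by apply: haar_mult_boundW (conj C0 H); rewrite lerDl divr_ge0 ?ltW.
clearbody C'.
have [Hj H2 H3 H4] := conditions_of_haar_mult W C'0 HC.
have root_le (k : \bar R) : (0 <= k)%E -> (k <= (4 * C' ^+ 2)%:E)%E ->
    (sqrte k <= (2 * C')%:E)%E.
  move=> k0 kC; have -> : (2 * C')%:E = sqrte (4 * C' ^+ 2)%:E.
    have -> : 4 * C' ^+ 2 = (2 * C') ^+ 2 by ring.
    by rewrite /= sqrtr_sqr ger0_norm// mulr_ge0// ltW.
  by rewrite lee_sqrt// (le_trans k0).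
rewrite !EFinD /conditions_size; apply: leeD.
  apply: leeD.
    apply: leeD.
      have -> : C'%:E = sqrte (C' ^+ 2)%:E by rewrite /= sqrtr_sqr ger0_norm// ltW.
      by rewrite lee_sqrt// lee_fin sqr_ge0.
    apply: root_le; first by apply: ereal_inf_const_ge0 => D [/ltW].
    by apply: ge_ereal_inf; exists (4 * C' ^+ 2)%:E => //; exists (4 * C' ^+ 2).
  apply: root_le; first by apply: ereal_inf_const_ge0 => D [/ltW].
  by apply: ge_ereal_inf; exists (4 * C' ^+ 2)%:E => //; exists (4 * C' ^+ 2).
by apply: ge_ereal_inf; exists (16 * C')%:E => //; exists (16 * C').
Qed.

Lemma two_weight_haar_mult (R : realType) (u v w : R -> R) (t : R) :
  positive_weights u v w ->
  (haar_mult_bounded u v w t <->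
     [/\ (joint_const u v w t < +oo)%E,
         carleson (winv u) (vw2t v w t) w t,
         carleson (vw2t v w t) (winv u) w t
       & pos_op_bounded u v w t]) /\
  approx_equiv 21 (haar_mult_norm u v w t) (conditions_size u v w t).
Proof.
move=> W; split.
  split=> [[C [C0 H]]|[Jy [C2 H2] [C3 H3] [C4 H4]]].
    have C10 : 0 < C + 1 by rewrite ltr_wpDl.
    have HC : haar_mult_bound u v w t (C + 1).
      by apply: haar_mult_boundW (conj C0 H); rewrite lerDl.
    have [Hj H2 H3 H4] := conditions_of_haar_mult W C10 HC.
    split; [exact: le_lt_trans Hj (ltry _)|by eexists; exact: H2
           |by eexists; exact: H3|by eexists; exact: H4].
  have Jj : (joint_const u v w t <= (fine (joint_const u v w t))%:E)%E.
    by rewrite fineK// ge0_fin_numE// joint_const_ge0.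
  by eexists; exact: haar_mult_of_conditions W Jj H2 H3 H4.
split; last exact: conditions_size_le.
rewrite lee_pdivrMl//; apply: (le_trans (haar_mult_norm_le t W)).
have S0 : (0 <= conditions_size u v w t)%E.
  rewrite /conditions_size !adde_ge0 ?sqrte_ge0//.
  by apply: ereal_inf_const_ge0 => C [].
rewrite -[leLHS]mul1e; apply: lee_wpmul2r => //; rewrite lee_fin; lra.
Qed.

(** * Changing weights on null sets *)

Definition ae_same (R : realType) (f g : R -> R) : Prop :=
  \forall x \ae @lebesgue_measure R, f x = g x.

Lemma ae_same_sym (R : realType) (f g : R -> R) : ae_same f g -> ae_same g f.
Proof. exact: ae_imply. Qed.

Lemma ae_imply2 (R : realType) (P Q S : R -> Prop) :
  (forall x, P x -> Q x -> S x) -> (\forall x \ae @lebesgue_measure R, P x) ->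
  (\forall x \ae @lebesgue_measure R, Q x) ->
  \forall x \ae @lebesgue_measure R, S x.
Proof. by move=> PQS; exact: (@filterS2 _ _ (ae_filter_ringOfSetsType leb)). Qed.

Lemma integral_ae_same (R : realType) (f g : R -> R)
    (D : set (measurableTypeR R)) :
  measurable D -> measurable_fun [set: R] f -> measurable_fun [set: R] g ->
  ae_same f g ->
  (\int[leb]_(x in D) (f x)%:E = \int[leb]_(x in D) (g x)%:E)%E.
Proof.
move=> mD mf mg fg; apply: ae_eq_integral => //; try exact: measurable_EFin.
by apply: ae_imply fg => x -> _.
Qed.

Lemma avge_ae_same (R : realType) (f g : R -> R) :
  measurable_fun [set: R] f -> measurable_fun [set: R] g -> ae_same f g ->
  avge f = avge g.
Proof.
move=> mf mg fg; apply/funext => I; rewrite /avge.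
by rewrite (integral_ae_same (@measurable_dset R I) mf mg fg).
Qed.

Lemma avg_ae_same (R : realType) (f g : R -> R) :
  measurable_fun [set: R] f -> measurable_fun [set: R] g -> ae_same f g ->
  avg f = avg g.
Proof. by move=> mf mg fg; rewrite /avg (avge_ae_same mf mg fg). Qed.

Lemma Delta_ae_same (R : realType) (f g : R -> R) :
  measurable_fun [set: R] f -> measurable_fun [set: R] g -> ae_same f g ->
  Delta f = Delta g.
Proof. by move=> mf mg fg; rewrite /Delta (avg_ae_same mf mg fg). Qed.

Lemma norm2_ae_same (R : realType) (u u' f f' : R -> R) :
  measurable_fun [set: R] u -> measurable_fun [set: R] u' ->
  measurable_fun [set: R] f -> measurable_fun [set: R] f' ->
  ae_same u u' -> ae_same f f' -> norm2 u f = norm2 u' f'.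
Proof.
move=> mu mu' mf mf' uu ff; rewrite /norm2; congr sqrte.
apply: (@integral_ae_same R (fun x => `|f x| ^+ 2 * u x)
  (fun x => `|f' x| ^+ 2 * u' x)) => //.
- by apply: measurable_funM => //; apply: measurable_funX; exact: measurableT_comp.
- by apply: measurable_funM => //; apply: measurable_funX; exact: measurableT_comp.
- by apply: ae_imply2 uu ff => x -> ->.
Qed.

Record ae_same_weights (R : realType) (u v w u' v' w' : R -> R) : Prop :=
  AeSameWeights {
    as_mu : measurable_fun [set: R] u; as_mu' : measurable_fun [set: R] u';
    as_mv : measurable_fun [set: R] v; as_mv' : measurable_fun [set: R] v';
    as_mw : measurable_fun [set: R] w; as_mw' : measurable_fun [set: R] w';
    as_u : ae_same u u'; as_v : ae_same v v'; as_w : ae_same w w' }.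

Lemma ae_same_weights_sym (R : realType) (u v w u' v' w' : R -> R) :
  ae_same_weights u v w u' v' w' -> ae_same_weights u' v' w' u v w.
Proof. by case=> *; split => //; exact: ae_same_sym. Qed.

Lemma measurable_haar_mult (R : realType) (w f : R -> R) (t : R)
    (sigma : dyadic -> R) (F : {fset dyadic}) :
  measurable_fun [set: R] w ->
  measurable_fun [set: R] (haar_mult w t sigma F f).
Proof.
move=> mw; apply: measurable_sum => I.
apply: measurable_funM; last by case: (test_haar R I).
apply: measurable_funM => //; apply: measurable_funM => //.
apply: (measurableT_comp (measurable_powR _)).
exact: measurable_funM.
Qed.

(** One implication is enough, the hypothesis on the weights being
    symmetric. *)
Lemma haar_mult_bound_ae_same (R : realType) (u v w u' v' w' : R -> R) (t C : R) :
  ae_same_weights u v w u' v' w' ->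
  haar_mult_bound u v w t C -> haar_mult_bound u' v' w' t C.
Proof.
move=> [mu mu' mv mv' mw mw' uu vv ww] [C0 H]; split => // sigma F f sg lf [mf nf].
have ff : ae_same f f by exact: aeW.
have nE := norm2_ae_same mu mu' mf mf uu ff.
have hh : ae_same (haar_mult w t sigma F f) (haar_mult w' t sigma F f).
  by apply: (ae_imply _ ww) => x wx; rewrite /haar_mult wx (avg_ae_same mw mw' ww).
have mh := @measurable_haar_mult R _ f t sigma F mw.
have mh' := @measurable_haar_mult R _ f t sigma F mw'.
rewrite -nE -(norm2_ae_same mv mv' mh mh' vv hh).
by apply: H => //; split; rewrite // nE.
Qed.

Lemma vw2t_ae_same (R : realType) (u v w u' v' w' : R -> R) (t : R) :
  ae_same_weights u v w u' v' w' -> ae_same (vw2t v w t) (vw2t v' w' t).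
Proof.
move=> W; apply: ae_imply2 (as_v W) (as_w W) => x vx wx.
by rewrite /vw2t vx wx.
Qed.

Lemma winv_ae_same (R : realType) (u v w u' v' w' : R -> R) :
  ae_same_weights u v w u' v' w' -> ae_same (winv u) (winv u').
Proof. by move=> W; apply: ae_imply (as_u W) => x ux; rewrite /winv ux. Qed.

Lemma joint_const_ae_same (R : realType) (u v w u' v' w' : R -> R) (t : R) :
  ae_same_weights u v w u' v' w' -> joint_const u v w t = joint_const u' v' w' t.
Proof.
move=> W; have uu := winv_ae_same W; have vv := vw2t_ae_same t W.
case: W => mu mu' mv mv' mw mw' _ _ ww.
rewrite /joint_const (avge_ae_same (measurable_winv mu) (measurable_winv mu') uu).
rewrite (avge_ae_same (measurable_vw2t t mv mw) (measurable_vw2t t mv' mw') vv).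
by rewrite (avg_ae_same mw mw' ww).
Qed.

Lemma carleson_bound_ae_same (R : realType) (a b w a' b' w' : R -> R) (t : R) :
  measurable_fun [set: R] a -> measurable_fun [set: R] a' ->
  measurable_fun [set: R] b -> measurable_fun [set: R] b' ->
  measurable_fun [set: R] w -> measurable_fun [set: R] w' ->
  ae_same a a' -> ae_same b b' -> ae_same w w' ->
  carleson_bound a b w t = carleson_bound a' b' w' t.
Proof.
move=> ma ma' mb mb' mw mw' aa bb ww; rewrite /carleson_bound.
rewrite (Delta_ae_same ma ma' aa) (avg_ae_same ma ma' aa) (avg_ae_same mb mb' bb).
by rewrite (avg_ae_same mw mw' ww).
Qed.

(** At a point where w and w' agree all the terms of the two series agree,
    as their coefficients depend on averages only. *)
Lemma pos_op_bound_ae_same (R : realType) (u v w u' v' w' : R -> R) (t C : R) :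
  ae_same_weights u v w u' v' w' ->
  pos_op_bound u v w t C -> pos_op_bound u' v' w' t C.
Proof.
move=> W [C0 H]; split => // f [mf nf].
have uu := winv_ae_same W; have vv := vw2t_ae_same t W.
case: W => mu mu' mv mv' mw mw' uu' vv' ww.
have ff : ae_same f f by exact: aeW.
have nE := norm2_ae_same mu mu' mf mf uu' ff.
have tE x : w x = w' x -> pos_term u v w t f x = pos_term u' v' w' t f x.
  move=> wx; apply/funext => I; rewrite /pos_term wx /lambda.
  rewrite (Delta_ae_same (measurable_winv mu) (measurable_winv mu') uu).
  rewrite (avg_ae_same (measurable_winv mu) (measurable_winv mu') uu).
  rewrite (Delta_ae_same (measurable_vw2t t mv mw) (measurable_vw2t t mv' mw') vv).
  rewrite (avg_ae_same (measurable_vw2t t mv mw) (measurable_vw2t t mv' mw') vv).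
  by rewrite (avg_ae_same mw mw' ww).
have [|aeS le] := H f; first by split; rewrite // nE.
split; first by apply: (ae_imply2 _ ww aeS) => x /tE ->.
have pp : ae_same (pos_op u v w t f) (pos_op u' v' w' t f).
  by apply: (ae_imply _ ww) => x /tE tx; rewrite /pos_op tx.
have mp := @measurable_pos_op R u v w f t mw.
have mp' := @measurable_pos_op R u' v' w' f t mw'.
by rewrite -nE -(norm2_ae_same mv mv' mp mp' vv' pp).
Qed.

(** Agrees almost everywhere with a weight w, and is positive and locally
    integrable. *)
Definition positive_version (R : realType) (w : R -> R) (x : R) : R :=
  if 0 < w x then w x else 1.

Lemma positive_version_gt0 (R : realType) (w : R -> R) x :
  0 < positive_version w x.
Proof. by rewrite /positive_version; case: ifP. Qed.

Lemma measurable_positive_version (R : realType) (w : R -> R) :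
  measurable_fun [set: R] w -> measurable_fun [set: R] (positive_version w).
Proof.
move=> mw; apply: measurable_fun_ifT => //.
by apply: measurable_fun_ltr => //; exact: measurable_cst.
Qed.

Lemma locint_positive_version (R : realType) (w : R -> R) :
  locint w -> locint (positive_version w).
Proof.
move=> lw; have mw := locint_measurable lw.
have mw' := measurable_positive_version mw.
apply: integrable_dsets_locint => // I.
have mI := @measurable_dset R I.
have := integrableD mI (integrable_abse (locint_dset I lw)) (locint_dset I (locint1 R)).
apply: le_integrable => //; first exact: measurable_EFin.
move=> x _ /=; rewrite lee_fin ger0_norm ?(ltW (positive_version_gt0 _ _))//.
rewrite [leRHS]ger0_norm ?addr_ge0// /positive_version; case: ifP => _.
  by rewrite -[leLHS]addr0 lerD// ler_norm.
by rewrite lerDr.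
Qed.

Lemma positive_version_ae (R : realType) (w : R -> R) :
  weight w -> ae_same w (positive_version w).
Proof.
by move=> [_ w0]; apply: ae_imply w0 => x wx; rewrite /positive_version wx.
Qed.

Theorem theorem1 (R : realType) :
  exists2 c : R, 0 < c &
  forall (u v w : R -> R) (t : R), weight u -> weight v -> weight w ->
    (haar_mult_bounded u v w t <->
       [/\ (joint_const u v w t < +oo)%E,
           carleson (winv u) (vw2t v w t) w t,
           carleson (vw2t v w t) (winv u) w t
         & pos_op_bounded u v w t]) /\
    approx_equiv c (haar_mult_norm u v w t)
      (sqrte (joint_const u v w t)
       + sqrte (carleson_const (winv u) (vw2t v w t) w t)
       + sqrte (carleson_const (vw2t v w t) (winv u) w t)
       + pos_op_norm u v w t)%E.
Proof.
exists 21 => // u v w t Wu Wv Ww.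
pose u' := positive_version u; pose v' := positive_version v.
pose w' := positive_version w.
have mu : measurable_fun [set: R] u by exact: locint_measurable Wu.1.
have mv : measurable_fun [set: R] v by exact: locint_measurable Wv.1.
have mw : measurable_fun [set: R] w by exact: locint_measurable Ww.1.
have W' : positive_weights u' v' w'.
  split; try exact: positive_version_gt0; try exact: measurable_positive_version.
  exact: locint_positive_version Ww.1.
have S : ae_same_weights u v w u' v' w'.
  by split => //; try exact: measurable_positive_version; exact: positive_version_ae.
have S' := ae_same_weights_sym S.
have [mu' _ mv' _ mw' _ _ _ ww'] := S'.
have ww := ae_same_sym ww'.
have hE : haar_mult_bound u v w t = haar_mult_bound u' v' w' t.
  by apply/funext => C; apply/propext; split; exact: haar_mult_bound_ae_same.
have pE : pos_op_bound u v w t = pos_op_bound u' v' w' t.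
  by apply/funext => C; apply/propext; split; exact: pos_op_bound_ae_same.
have cE : carleson_bound (winv u) (vw2t v w t) w t =
    carleson_bound (winv u') (vw2t v' w' t) w' t.
  apply: carleson_bound_ae_same => //; try exact: measurable_winv;
    try exact: measurable_vw2t; [exact: winv_ae_same S|exact: vw2t_ae_same S].
have dE : carleson_bound (vw2t v w t) (winv u) w t =
    carleson_bound (vw2t v' w' t) (winv u') w' t.
  apply: carleson_bound_ae_same => //; try exact: measurable_winv;
    try exact: measurable_vw2t; [exact: vw2t_ae_same S|exact: winv_ae_same S].
have := two_weight_haar_mult t W'.
rewrite /haar_mult_bounded /haar_mult_norm /conditions_size /carleson.
rewrite /carleson_const /pos_op_bounded /pos_op_norm.
by rewrite -(joint_const_ae_same t S) -hE -pE -cE -dE.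
Qed.
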